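(* Let $\mathcal{K}\subseteq\mathbb{R}^{m,n}$ be a compact convex set with $\min\{m,n\}>e$ and assume that there is some $D\ge1$ such that $\|x\|_1\le D$ (nuclear norm) for all $x\in\mathcal{K}$. Set $$\beta=\frac{1}{\min\{m,n\}},\qquad \eta=\sqrt{\frac{1}{\ln(D+1)+\ln\min\{m,n\}}},\qquad \alpha_t=\eta\sqrt{\sum_{s=1}^{t-1}\|g_s-h_s\|_\infty^2},$$ and $\Phi_t=\phi_t\circ\sigma:\mathbb{R}^{m,n}\to\mathbb{R}$, where $\sigma(x)\in\mathbb{R}^{\min\{m,n\}}$ is the vector of singular values of $x$ and $$\phi_t(v)=\alpha_t\sum_{i=1}^{\min\{m,n\}}\Big((|v_i|+\beta)\ln\Big(\frac{|v_i|}{\beta}+1\Big)-|v_i|\Big),\quad v\in\mathbb{R}^{\min\{m,n\}}.$$ Let $\{x_t\}$ be a sequence generated by the update rule (adaptive optimistic follow-the-regularised-leader) $$x_{t+1}\in\arg\min_{x\in\mathcal{K}}\ \Big\langle\sum_{s=1}^t g_s+h_{t+1},x\Big\rangle+\sum_{s=1}^{t+1}r_s(x)+\mathcal{B}_{\Phi_{t+1}}(x,x_1),\qquad t\ge0,$$ where $g_t\in\partial l_t(x_t)$ and $\{h_t\}$ is a sequence of hint matrices; for $t=0$, since $\alpha_1=0$, this means $x_1\in\arg\min_{x\in\mathcal{K}}\langle h_1,x\rangle+r_1(x)$. Then $$\mathcal{R}_{1:T}\le c(m,n,D)\sqrt{\sum_{t=1}^T\|g_t-h_t\|_\infty^2}$$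 with $c(m,n,D)\in\mathcal{O}\big(D\sqrt{\ln(D+1)+\ln\min\{m,n\}}\big)$.
   Context: Online composite convex optimisation over $T$ rounds with matrix decisions: in round $t$ the player chooses $x_t\in\mathcal{K}$, then a convex function $l_t:\mathcal{K}\to\mathbb{R}$ is revealed and the player suffers $f_t(x_t)$, where $f_t=l_t+r_t$ and $r_t:\mathbb{R}^{m,n}\to\mathbb{R}_{\ge0}$ is a known closed convex function. The regret is $\mathcal{R}_{1:T}=\sum_{t=1}^T f_t(x_t)-\min_{x\in\mathcal{K}}\sum_{t=1}^T f_t(x)$. $\langle\cdot,\cdot\rangle$ is the Frobenius inner product; for matrices $\|\cdot\|_1$ is the nuclear norm and $\|\cdot\|_\infty$ the spectral norm. The subgradient set is $\partial l_t(y)=\{g : l_t(x)-l_t(y)\ge\langle g,x-y\rangle\ \forall x\in\mathcal{K}\}$. The hints $h_t\in\mathbb{R}^{m,n}$ are arbitrary ($h_{t+1}$ is available when $x_{t+1}$ is chosen). $\mathcal{B}_\Phi(x,y)=\Phi(x)-\Phi(y)-\langle\nabla\Phi(y),x-y\rangle$ is the Bregman divergence. If the minimiser in the update is not unique, any minimiser may be taken. The quantity $c(m,n,D)$ depends only on $m,n,D$; $c\in\mathcal{O}(h)$ means that there are absolute constants $C$, $D_0$, $d_0$ with $c(m,n,D)\le C\,h(m,n,D)$ for all $D\ge D_0$ and $\min\{m,n\}\ge d_0$. *)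

(* Defs.v *)
From HB Require Import structures.
From mathcomp Require Import all_boot all_order all_algebra.
From mathcomp Require Import all_classical all_reals all_analysis.
Import Order.TTheory GRing.Theory Num.Theory.
Import numFieldNormedType.Exports.

Set Implicit Arguments.
Unset Strict Implicit.
Unset Printing Implicit Defensive.

Local Open Scope classical_set_scope.
Local Open Scope ring_scope.

(* The library norm on 'M[R]_(m, n) is the entrywise sup norm; it is used only for
   the (norm-independent) topology: compactness, closedness and derivatives. *)

Section Matrices.
Context {R : realType} {m n : nat}.
Implicit Types (x y : 'M[R]_(m, n)) (s : 'rV[R]_(minn m n)).

Definition frob x y : R := \tr (x^T *m y).

(* The m x n matrix with s_k in position (k, k) and 0 off the diagonal. *)
Definition rect_diag s : 'M[R]_(m, n) :=
  \matrix_(i, j) \sum_(k < minn m n)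
    s ord0 k *+ ((i == k :> nat) && (j == k :> nat)).

Definition is_singular_values x s : Prop :=
  [/\ forall i, 0 <= s ord0 i,
      forall i j : 'I_(minn m n), (i <= j)%N -> s ord0 j <= s ord0 i &
      exists (U : 'M[R]_m) (V : 'M[R]_n),
        [/\ U *m U^T = 1%:M, V *m V^T = 1%:M & x = U *m rect_diag s *m V^T]].

(* Every real matrix has a singular value decomposition and its singular values
   in nonincreasing order are unique, so the default 0 of xget is never used
   and the choice made by xget is immaterial. *)
Definition sigma x : 'rV[R]_(minn m n) := xget 0 [set s | is_singular_values x s].

Definition nuclear_norm x : R := \sum_i sigma x ord0 i.

Definition spectral_norm x : R := \big[Num.max/0]_i sigma x ord0 i.

Definition subdifferential (K : set 'M[R]_(m, n)) (l : 'M[R]_(m, n) -> R) y :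
    set 'M[R]_(m, n) :=
  [set g | forall x, K x -> frob g (x - y) <= l x - l y].

(* Closed in the sense of convex analysis: the epigraph is a closed set. *)
Definition closed_function (f : 'M[R]_(m, n) -> R) : Prop :=
  closed [set p : 'M[R]_(m, n) * R | f p.1 <= p.2].

Definition argmin (K : set 'M[R]_(m, n)) (f : 'M[R]_(m, n) -> R) :
    set 'M[R]_(m, n) :=
  [set x | K x /\ forall y, K y -> f x <= f y].

Definition grad (F : 'M[R]_(m, n) -> R) y : 'M[R]_(m, n) :=
  \matrix_(i, j) 'D_(delta_mx i j) (F : 'M[R]_(m, n) -> R^o) y.

Definition bregman (F : 'M[R]_(m, n) -> R) x y : R :=
  F x - F y - frob (grad F y) (x - y).

End Matrices.

Definition ent_reg {R : realType} {d : nat} (alpha beta : R) (v : 'rV[R]_d) : R :=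
  alpha * \sum_i ((`|v ord0 i| + beta) * ln (`|v ord0 i| / beta + 1)
                  - `|v ord0 i|).

Definition log_dim {R : realType} (m n : nat) (D : R) : R :=
  ln (D + 1) + ln (minn m n)%:R.

Definition eta {R : realType} (m n : nat) (D : R) : R :=
  Num.sqrt (1 / log_dim m n D).

Section OnlineLearning.
Context {R : realType} {m n : nat}.
Implicit Types (K : set 'M[R]_(m, n)) (g h x : nat -> 'M[R]_(m, n)).
Implicit Types (l r Phi : nat -> 'M[R]_(m, n) -> R).

(* Rounds are numbered 1, ..., T; index 0 of a sequence is never used. *)

Definition alpha (D : R) g h (t : nat) : R :=
  eta m n D * Num.sqrt (\sum_(1 <= s < t) spectral_norm (g s - h s) ^+ 2).

Definition spectral_reg (D : R) g h (t : nat) (X : 'M[R]_(m, n)) : R :=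
  ent_reg (alpha D g h t) ((minn m n)%:R^-1) (sigma X).

(* Objective minimised by x_(t+1). *)
Definition ftrl_objective r g h Phi (x1 : 'M[R]_(m, n)) (t : nat)
    (X : 'M[R]_(m, n)) : R :=
  frob (\sum_(1 <= s < t.+1) g s + h t.+1) X
  + \sum_(1 <= s < t.+2) r s X + bregman (Phi t.+1) X x1.

(* For t = 0 the centre x 1 also occurs in the objective defining x 1; this is
   not circular when Phi 1 = 0, since the Bregman term then vanishes. *)
Definition ftrl_update K r g h Phi x (T : nat) : Prop :=
  forall t, (t < T)%N -> argmin K (ftrl_objective r g h Phi (x 1%N) t) (x t.+1).

Definition cumulative_loss l r (T : nat) x : R :=
  \sum_(1 <= t < T.+1) (l t (x t) + r t (x t)).

(* The best fixed loss is an infimum because convex losses on a compact set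
   need not attain their minimum; it equals the minimum when there is one. *)
Definition regret K l r x (T : nat) : R :=
  cumulative_loss l r T x
  - inf [set cumulative_loss l r T (fun=> u) | u in K].

End OnlineLearning.

(* Main.v *)
Require Import Defs.
From HB Require Import structures.
From mathcomp Require Import all_boot all_order all_algebra.
From mathcomp Require Import all_classical all_reals all_analysis.
From mathcomp Require Import ring lra.
Import Order.TTheory GRing.Theory Num.Theory.
Import numFieldNormedType.Exports.

(** The proof bounds, for every comparator [u] in [K], the linearised regret
    [sum_t (<g_t, x_t - u> + r_t(x_t) - r_t(u))].  Write [a_t] for the
    spectral norm of [g_t - h_t], [S_t] for the square root of
    [sum_(s < t) a_s^2], [d = minn m n], [b = 1 / d], and
    [L = ln (D + 1) + ln d], so that the regulariser of round [t] is
    [(S_t / sqrt L) * Psi] with [Psi] the spectral function of the scalar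
    potential [ent b].

    The induction [oftrl_bound] for optimistic follow-the-regularised-leader
    bounds the regret by [(S_T / sqrt L) * B(u, x_1)] plus the stability terms
    [<g_t - h_t, x_t - u_t> - (S_t / sqrt L) * B(u_t, x_t)], where [B] is
    the Bregman divergence of [Psi] and [u_t] is arbitrary in [K].  The first
    summand is at most [4 D sqrt L S_T], because the divergence has diameter
    [4 D L] on the nuclear norm ball ([potential_diameter]).  Strong
    convexity bounds a stability term by [3 D sqrt L a_t^2 / S_t], while
    trivially it is at most [2 D a_t]; whichever is better is at most
    [9 D sqrt L (S_(t+1) - S_t)] ([stability_telescopes]), and these
    telescope.  This gives the constant 13.

    What is needed of [Psi] is convexity, smoothness (for its gradient to
    exist and for first-order optimality) and strong convexity relative to
    the nuclear norm, with modulus of the order of [1 / D].  All three come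
    from one exact formula, [svd_bregman]: if [X = U diag(s) V^T],
    [Y = U' diag(t) V'^T], [P = U^T U'] and [Q = V^T V'], then
    [B(Y, X)] is the sum over [i, j] of
    [((P_ij + Q_ij) / 2)^2 beta(t_j, s_i)] and
    [((P_ij - Q_ij) / 2)^2 beta(- t_j, s_i)], with [beta] the scalar
    divergence of [ent b].  Convexity and smoothness are then the scalar
    bounds [0 <= beta(v, s) <= (v - s)^2 / b].  For strong convexity, expand
    [<W, Y - X>] in the same mixed bases and apply a Young inequality
    termwise with [(v - s)^2 <= 2 (|v| + s + 2 b) beta(v, s)], an instance of
    relative entropy dominating the squared Hellinger distance
    ([svd_stability]); no differentiation of eigenvalues and no duality
    theory is involved.

    The formula is proved for square matrices; rectangular ones are padded
    with zeros.  Any singular value decomposition will do, so only existence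
    ([svd_exists]) is required to know that [sigma] is meaningful. *)

Set Implicit Arguments.
Unset Strict Implicit.
Unset Printing Implicit Defensive.

Local Open Scope classical_set_scope.
Local Open Scope ring_scope.

(** * The Frobenius inner product *)

Section FrobeniusProduct.
Variable R : realType.

Lemma frobE m n (x y : 'M[R]_(m, n)) : frob x y = \sum_i \sum_j x i j * y i j.
Proof.
rewrite /frob /mxtrace exchange_big /=; apply: eq_bigr => j _.
by rewrite mxE; apply: eq_bigr => i _; rewrite mxE.
Qed.

Lemma frobC m n (x y : 'M[R]_(m, n)) : frob x y = frob y x.
Proof.
by rewrite !frobE; apply: eq_bigr => i _; apply: eq_bigr => j _; rewrite mulrC.
Qed.

Lemma frobDr m n (x y z : 'M[R]_(m, n)) : frob x (y + z) = frob x y + frob x z.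
Proof. by rewrite /frob mulmxDr mxtraceD. Qed.

Lemma frobZr m n a (x y : 'M[R]_(m, n)) : frob x (a *: y) = a * frob x y.
Proof. by rewrite /frob -scalemxAr mxtraceZ. Qed.

Lemma frobNr m n (x y : 'M[R]_(m, n)) : frob x (- y) = - frob x y.
Proof. by rewrite -scaleN1r frobZr mulN1r. Qed.

Lemma frobBr m n (x y z : 'M[R]_(m, n)) : frob x (y - z) = frob x y - frob x z.
Proof. by rewrite frobDr frobNr. Qed.

Lemma frobDl m n (x y z : 'M[R]_(m, n)) : frob (x + y) z = frob x z + frob y z.
Proof. by rewrite !(frobC _ z) frobDr. Qed.

Lemma frobZl m n a (x y : 'M[R]_(m, n)) : frob (a *: x) y = a * frob x y.
Proof. by rewrite !(frobC _ y) frobZr. Qed.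

Lemma frobNl m n (x y : 'M[R]_(m, n)) : frob (- x) y = - frob x y.
Proof. by rewrite !(frobC _ y) frobNr. Qed.

Lemma frobBl m n (x y z : 'M[R]_(m, n)) : frob (x - y) z = frob x z - frob y z.
Proof. by rewrite !(frobC _ z) frobBr. Qed.

Lemma frob0r m n (x : 'M[R]_(m, n)) : frob x 0 = 0.
Proof. by rewrite -(scale0r x) frobZr mul0r. Qed.

Lemma frob_delta m n (x : 'M[R]_(m, n)) i j : frob x (delta_mx i j) = x i j.
Proof.
rewrite frobE (bigD1 i) //= (bigD1 j) //= mxE !eqxx mulr1 !big1 ?addr0 //.
- by move=> k ki; rewrite big1 // => l _; rewrite mxE (negbTE ki) mulr0.
- by move=> l lj; rewrite mxE (negbTE lj) andbF mulr0.
Qed.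

Lemma frob_ge0 m n (x : 'M[R]_(m, n)) : 0 <= frob x x.
Proof.
by rewrite frobE; do 2!(apply: sumr_ge0 => ? _); rewrite -expr2 sqr_ge0.
Qed.

Lemma frob_eq0 m n (x : 'M[R]_(m, n)) : frob x x = 0 -> x = 0.
Proof.
rewrite frobE => /psumr_eq0P H; apply/matrixP => i j; rewrite mxE.
have /psumr_eq0P H2 : \sum_j x i j * x i j = 0.
  by apply: H => // k _; apply: sumr_ge0 => l _; rewrite -expr2 sqr_ge0.
have /eqP : x i j * x i j = 0 by apply: H2 => // l _; rewrite -expr2 sqr_ge0.
by rewrite mulf_eq0 orbb => /eqP.
Qed.

Lemma frob_mulmxA m n p (A : 'M[R]_(m, n)) (B : 'M[R]_(n, p)) C :
  frob (A *m B) C = frob B (A^T *m C).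
Proof. by rewrite /frob trmx_mul mulmxA. Qed.

Lemma frob_mulmxAr m n p (A : 'M[R]_(m, n)) (B : 'M[R]_(n, p)) C :
  frob (A *m B) C = frob A (C *m B^T).
Proof.
by rewrite /frob trmx_mul -mulmxA mxtrace_mulC mulmxA.
Qed.

Lemma frob_diag n (A : 'M[R]_n) (s : 'rV[R]_n) :
  frob A (diag_mx s) = \sum_i s ord0 i * A i i.
Proof.
rewrite frobE; apply: eq_bigr => i _; rewrite (bigD1 i) //= mxE eqxx mulr1n.
rewrite big1 ?addr0 ?(mulrC (A i i)) // => j ji.
by rewrite mxE eq_sym (negbTE ji) mulr0.
Qed.

Lemma frob_svd m n p (W : 'M[R]_(m, n)) (U : 'M[R]_(m, p)) (s : 'rV[R]_p)
    (V : 'M[R]_(n, p)) :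
  frob W (U *m diag_mx s *m V^T) = \sum_i s ord0 i * (U^T *m W *m V) i i.
Proof. by rewrite frobC frob_mulmxAr frob_mulmxA frobC trmxK mulmxA frob_diag. Qed.

End FrobeniusProduct.

(** * Comparing two singular value decompositions *)

Section OrthogonalPolarization.
Variables (R : realType) (N : nat).
Implicit Types (P Q U V : 'M[R]_N) (a s t : 'rV[R]_N).

Lemma orthoC U : U *m U^T = 1%:M -> U^T *m U = 1%:M.
Proof. exact: mulmx1C. Qed.

Lemma ortho_trmxM U V : U *m U^T = 1%:M -> V *m V^T = 1%:M ->
  (U^T *m V) *m (U^T *m V)^T = 1%:M.
Proof.
by move=> HU HV; rewrite trmx_mul trmxK mulmxA -(mulmxA U^T) HV mulmx1 orthoC.
Qed.

Lemma ortho_row P i : P *m P^T = 1%:M -> \sum_j P i j ^+ 2 = 1.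
Proof.
move=> /matrixP /(_ i i); rewrite !mxE eqxx mulr1n => <-.
by apply: eq_bigr => j _; rewrite mxE expr2.
Qed.

Lemma ortho_col P j : P *m P^T = 1%:M -> \sum_i P i j ^+ 2 = 1.
Proof.
move=> /orthoC HP; rewrite -(@ortho_row P^T j) ?trmxK //.
by apply: eq_bigr => i _; rewrite mxE.
Qed.

(** With [P] and [Q] orthogonal, the squares of [(P + Q) / 2] and [(P - Q) /
    2] together form a doubly stochastic array of weights, since they add up
    to [(P^2 + Q^2) / 2] entrywise. The sign passed to [F] tells which of the
    two squares a term carries; it is the sign with which the pair of singular
    values [(s_i, t_j)] meets in the symmetric dilation of the two matrices.
    *)
Definition mixed_sum P Q (F : R -> 'I_N -> 'I_N -> R) : R :=
  \sum_i \sum_j (((P i j + Q i j) / 2) ^+ 2 * F 1 i j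
               + ((P i j - Q i j) / 2) ^+ 2 * F (- 1) i j).

(** Double stochasticity collects the terms depending on one index only, and
    polarisation, [((P + Q)^2 - (P - Q)^2) / 4 = P Q], the product term. *)
Lemma mixed_sumE P Q (c d a t : 'I_N -> R) :
  P *m P^T = 1%:M -> Q *m Q^T = 1%:M ->
  mixed_sum P Q (fun e i j => c j + d i - a i * (e * t j)) =
  \sum_j c j + \sum_i d i - \sum_i \sum_j a i * t j * (P i j * Q i j).
Proof.
move=> HP HQ; rewrite /mixed_sum.
have -> : \sum_i d i = \sum_i \sum_j d i * ((P i j ^+ 2 + Q i j ^+ 2) / 2).
  apply: eq_bigr => i _; rewrite -mulr_sumr -mulr_suml big_split /=.
  by rewrite !ortho_row // (_ : (1 + 1) / 2 = 1) ?mulr1 //; field.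
have -> : \sum_j c j = \sum_i \sum_j c j * ((P i j ^+ 2 + Q i j ^+ 2) / 2).
  rewrite exchange_big; apply: eq_bigr => j _.
  rewrite -mulr_sumr -mulr_suml big_split /= !ortho_col //.
  by rewrite (_ : (1 + 1) / 2 = 1) ?mulr1 //; field.
rewrite -big_split -sumrB /=; apply: eq_bigr => i _.
rewrite -big_split -sumrB /=; apply: eq_bigr => j _.
by field.
Qed.

Lemma frob_svd_svd U V a U' V' t :
  frob (U *m diag_mx a *m V^T) (U' *m diag_mx t *m V'^T) =
  \sum_i \sum_j a ord0 i * t ord0 j * ((U^T *m U') i j * (V^T *m V') i j).
Proof.
rewrite frob_svd exchange_big /=; apply: eq_bigr => j _.
have -> : U'^T *m (U *m diag_mx a *m V^T) *m V' =
   (U'^T *m U) *m (diag_mx a *m (V^T *m V')) by rewrite !mulmxA.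
rewrite mxE mulr_sumr; apply: eq_bigr => i _.
rewrite mul_diag_mx !mxE.
have -> : \sum_k U'^T j k * U k i = \sum_k U^T i k * U' k j.
  by apply: eq_bigr => k _; rewrite !mxE mulrC.
by ring.
Qed.

End OrthogonalPolarization.
Section SpectralIdentities.
Variables (R : realType) (N : nat).
Implicit Types (P Q U V W X Y : 'M[R]_N) (a s t z : 'rV[R]_N).

Lemma ler_mixed_sum P Q F G :
  (forall i j, F 1 i j <= G 1 i j) -> (forall i j, F (- 1) i j <= G (- 1) i j) ->
  mixed_sum P Q F <= mixed_sum P Q G.
Proof.
move=> H1 H2; do 2!(apply: ler_sum => ? _).
by apply: lerD; rewrite ler_wpM2l ?sqr_ge0.
Qed.

Lemma eq_mixed_sum P Q F G :
  (forall i j, F 1 i j = G 1 i j) -> (forall i j, F (- 1) i j = G (- 1) i j) ->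
  mixed_sum P Q F = mixed_sum P Q G.
Proof.
move=> H1 H2; apply/le_anti/andP.
by split; apply: ler_mixed_sum => i j; rewrite ?H1 ?H2.
Qed.

Lemma mixed_sumZ P Q k F :
  k * mixed_sum P Q F = mixed_sum P Q (fun e i j => k * F e i j).
Proof.
rewrite /mixed_sum mulr_sumr; apply: eq_bigr => i _; rewrite mulr_sumr.
by apply: eq_bigr => j _; ring.
Qed.

Lemma frob_svd_same U V a s : U *m U^T = 1%:M -> V *m V^T = 1%:M ->
  frob (U *m diag_mx a *m V^T) (U *m diag_mx s *m V^T) =
  \sum_i a ord0 i * s ord0 i.
Proof.
move=> HU HV; rewrite frob_svd; apply: eq_bigr => i _.
rewrite !mulmxA orthoC // mul1mx -mulmxA orthoC // mulmx1 !mxE eqxx mulr1n.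
by rewrite mulrC.
Qed.

Section TwoDecompositions.
Variables (U V U' V' : 'M[R]_N) (s t : 'rV[R]_N).
Hypotheses (HU : U *m U^T = 1%:M) (HV : V *m V^T = 1%:M).
Hypotheses (HU' : U' *m U'^T = 1%:M) (HV' : V' *m V'^T = 1%:M).

Let X := U *m diag_mx s *m V^T.
Let Y := U' *m diag_mx t *m V'^T.
Let P := U^T *m U'.
Let Q := V^T *m V'.
Let HP : P *m P^T = 1%:M. Proof. exact: ortho_trmxM. Qed.
Let HQ : Q *m Q^T = 1%:M. Proof. exact: ortho_trmxM. Qed.

(** The Bregman divergence of an even spectral function is an average, with
    nonnegative weights, of scalar Bregman divergences between the singular
    values of the two matrices. Every scalar inequality therefore transfers to
    matrices, without von Neumann's trace inequality and without any ordering
    of the singular values. *)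
Lemma svd_bregman (f df : R -> R) : (forall v, f (- v) = f v) ->
  \sum_j f (t ord0 j) - \sum_i f (s ord0 i)
    - frob (U *m diag_mx (map_mx df s) *m V^T) (Y - X) =
  mixed_sum P Q (fun e i j =>
    f (e * t ord0 j) - f (s ord0 i) - df (s ord0 i) * (e * t ord0 j - s ord0 i)).
Proof.
move=> fN; rewrite frobBr frob_svd_svd -/P -/Q.
have -> : \sum_i \sum_j (map_mx df s) ord0 i * t ord0 j * (P i j * Q i j) =
    \sum_i \sum_j df (s ord0 i) * t ord0 j * (P i j * Q i j).
  by do 2!(apply: eq_bigr => ? _); rewrite mxE.
have -> : frob (U *m diag_mx (map_mx df s) *m V^T) X =
    \sum_i df (s ord0 i) * s ord0 i.
  by rewrite /X frob_svd_same //; apply: eq_bigr => i _; rewrite mxE.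
have := @mixed_sumE R N P Q (fun j => f (t ord0 j))
  (fun i => df (s ord0 i) * s ord0 i - f (s ord0 i)) (fun i => df (s ord0 i))
  (fun j => t ord0 j) HP HQ.
rewrite sumrB /= => E.
transitivity (mixed_sum P Q (fun e i j => f (t ord0 j) +
   (df (s ord0 i) * s ord0 i - f (s ord0 i)) - df (s ord0 i) * (e * t ord0 j))).
  by rewrite E; ring.
by apply: eq_mixed_sum => i j; rewrite ?mul1r ?mulN1r ?fN; ring.
Qed.

(** The case of the square function, whose divergence is the squared distance.
    *)
Lemma svd_dist : frob (Y - X) (Y - X) =
  mixed_sum P Q (fun e i j => (e * t ord0 j - s ord0 i) ^+ 2).
Proof.
have HXX : frob X X = \sum_i s ord0 i ^+ 2.
  by rewrite /X frob_svd_same //; apply: eq_bigr => i _; rewrite expr2.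
have HYY : frob Y Y = \sum_i t ord0 i ^+ 2.
  by rewrite /Y frob_svd_same //; apply: eq_bigr => i _; rewrite expr2.
have := @svd_bregman (fun v => v ^+ 2) (fun v => 2 * v) (@sqrrN R).
have -> : U *m diag_mx (map_mx (fun v => 2 * v) s) *m V^T = 2 *: X.
  rewrite /X scalemxAl scalemxAr; congr (_ *m _ *m _).
  by apply/matrixP => i j; rewrite !mxE mulrnAr.
rewrite frobZl -HXX -HYY !frobBr !frobBl (frobC Y X) => E.
transitivity (frob Y Y - frob X X - 2 * (frob X Y - frob X X)); first by ring.
by rewrite E; apply: eq_mixed_sum => i j; ring.
Qed.

(** Duality of the spectral and nuclear norms: [A * t_j] dominates [s_i * t_j]
    with either sign, so the mixed sum is nonnegative. *)
Lemma svd_holder A : (forall i, `|s ord0 i| <= A) -> (forall j, 0 <= t ord0 j) ->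
  frob X Y <= A * \sum_j t ord0 j.
Proof.
move=> sA t0; rewrite /X /Y frob_svd_svd.
have := @mixed_sumE R N P Q (fun j => A * t ord0 j) (fun=> 0)
  (fun i => s ord0 i) (fun j => t ord0 j) HP HQ.
rewrite -mulr_sumr [\sum_(i < N) 0]big1 // addr0 => E.
rewrite -subr_ge0 -E /mixed_sum; do 2!(apply: sumr_ge0 => ? _).
have Hs i j : `|s ord0 i * t ord0 j| <= A * t ord0 j.
  by rewrite normrM (ger0_norm (t0 j)) ler_wpM2r.
apply: addr_ge0; apply: mulr_ge0; rewrite ?sqr_ge0 // ?mul1r ?mulN1r addr0 subr_ge0.
  exact: le_trans (ler_norm _) (Hs _ _).
by rewrite mulrN (le_trans (ler_norm _)) // normrN.
Qed.

End TwoDecompositions.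

Section Contraction.
Variables (U V O1 O2 : 'M[R]_N) (z : 'rV[R]_N) (A : R).
Hypotheses (HU : U *m U^T = 1%:M) (HV : V *m V^T = 1%:M).
Hypotheses (HO1 : O1 *m O1^T = 1%:M) (HO2 : O2 *m O2^T = 1%:M).
Hypothesis zA : forall k, `|z ord0 k| <= A.

(** Orthogonal changes of basis do not increase a row beyond the spectral
    norm: the row has squared norm [sum_k O_ik^2 z_k^2] for an orthogonal [O].
    *)
Lemma svd_row_le i :
  \sum_j (O1^T *m (U *m diag_mx z *m V^T) *m O2) i j ^+ 2 <= A ^+ 2.
Proof.
set M := _ *m O2.
have -> : \sum_j M i j ^+ 2 = \sum_k (O1^T *m U) i k ^+ 2 * z ord0 k ^+ 2.
  transitivity ((M *m M^T) i i).
    by rewrite [RHS]mxE; apply: eq_bigr => j _; rewrite [M^T _ _]mxE expr2.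
  have -> : M *m M^T =
     (O1^T *m U *m diag_mx z) *m (O1^T *m U *m diag_mx z)^T.
    rewrite /M !trmx_mul !trmxK !mulmxA -(mulmxA _ O2) HO2 mulmx1.
    by rewrite -(mulmxA _ V^T V) orthoC // mulmx1.
  rewrite mxE; apply: eq_bigr => k _.
  by rewrite [_^T _ _]mxE -expr2 mul_mx_diag [X in X ^+ 2 = _]mxE exprMn.
have := @ortho_row R N (O1^T *m U) i (ortho_trmxM HO1 HU).
move=> H; rewrite -[leRHS]mul1r -H mulr_suml; apply: ler_sum => k _.
rewrite ler_wpM2l ?sqr_ge0 // -real_normK ?num_real //.
by rewrite ler_sqr ?nnegrE // (le_trans _ (zA k)).
Qed.

End Contraction.

Lemma svd_col_le U V (O1 O2 : 'M[R]_N) z A :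
  U *m U^T = 1%:M -> V *m V^T = 1%:M ->
  O1 *m O1^T = 1%:M -> O2 *m O2^T = 1%:M ->
  (forall k, `|z ord0 k| <= A) -> forall j,
  \sum_i (O1^T *m (U *m diag_mx z *m V^T) *m O2) i j ^+ 2 <= A ^+ 2.
Proof.
move=> HU HV HO1 HO2 zA j.
rewrite (le_trans _ (svd_row_le HV HU HO2 HO1 zA j)) // le_eqVlt; apply/orP; left.
apply/eqP/eq_bigr => i _; congr (_ ^+ 2).
have -> : O2^T *m (V *m diag_mx z *m U^T) *m O1 =
  (O1^T *m (U *m diag_mx z *m V^T) *m O2)^T.
  by rewrite !trmx_mul !trmxK tr_diag_mx !mulmxA.
by rewrite [RHS]mxE.
Qed.

(** The product is at most [|x| * sqrt (2 w b)], to which the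
    arithmetic-geometric mean inequality applies. *)
Lemma young_weighted (x y w b al : R) : 0 < al -> 0 <= w -> 0 <= b ->
  y ^+ 2 <= 2 * w * b -> x * y <= al * b + w * x ^+ 2 / (2 * al).
Proof.
move=> al0 w0 b0 H.
have [w00|wn0] := eqVneq w 0.
  move: H; rewrite w00 mulr0 mul0r => H.
  have /eqP : y ^+ 2 = 0 by apply/le_anti; rewrite H sqr_ge0.
  rewrite sqrf_eq0 => /eqP ->; rewrite mulr0 !mul0r addr0 mulr_ge0 // ltW //.
have wp : 0 < w by rewrite lt_def wn0.
rewrite -subr_ge0.
have -> : al * b + w * x ^+ 2 / (2 * al) - x * y =
   (al * (2 * w * b - y ^+ 2) + (al * y - w * x) ^+ 2 / al) / (2 * w).
  by field; rewrite !gt_eqF.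
apply: divr_ge0; last by lra.
apply: addr_ge0; first by rewrite mulr_ge0 ?subr_ge0 // ltW.
by rewrite divr_ge0 ?sqr_ge0 // ltW.
Qed.

Section Stability.
Variables (U V U' V' U0 V0 : 'M[R]_N) (s t z : 'rV[R]_N).
Hypotheses (HU : U *m U^T = 1%:M) (HV : V *m V^T = 1%:M).
Hypotheses (HU' : U' *m U'^T = 1%:M) (HV' : V' *m V'^T = 1%:M).
Hypotheses (HU0 : U0 *m U0^T = 1%:M) (HV0 : V0 *m V0^T = 1%:M).

(** Strong convexity with respect to the nuclear norm, in dual form. In the
    bases of the two decompositions [Y - X] has entries [t_j P_ij - s_i Q_ij]
    and [t_j Q_ij - s_i P_ij], which are combinations of [t_j - s_i] and [t_j
    + s_i] with the coefficients that appear in the mixed sum, while the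
    matrix of [W] has rows and columns of norm at most [A]. Splitting each
    product by a weighted Young inequality, the weights only enter through
    their sums, that is through nuclear norms. *)
Lemma svd_stability (F : R -> 'I_N -> 'I_N -> R) (w w' : 'I_N -> R) (A al : R) :
  (forall k, `|z ord0 k| <= A) -> 0 < al ->
  (forall i, 0 <= w i) -> (forall j, 0 <= w' j) ->
  (forall i j, 0 <= F 1 i j) -> (forall i j, 0 <= F (- 1) i j) ->
  (forall i j, (1 * t ord0 j - s ord0 i) ^+ 2 <= 2 * (w i + w' j) * F 1 i j) ->
  (forall i j, (- 1 * t ord0 j - s ord0 i) ^+ 2
     <= 2 * (w i + w' j) * F (- 1) i j) ->
  frob (U0 *m diag_mx z *m V0^T)
    (U' *m diag_mx t *m V'^T - U *m diag_mx s *m V^T) <=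
  al * mixed_sum (U^T *m U') (V^T *m V') F
  + A ^+ 2 * (\sum_i w i + \sum_j w' j) / (2 * al).
Proof.
move=> zA al0 w0 w'0 F0 F1 H0 H1.
set W := U0 *m _ *m _; set P := U^T *m U'; set Q := V^T *m V'.
have Rr (O1 O2 : 'M[R]_N) : O1 *m O1^T = 1%:M -> O2 *m O2^T = 1%:M ->
    forall i, \sum_j (O1^T *m W *m O2) i j ^+ 2 <= A ^+ 2.
  by move=> *; apply: svd_row_le.
have Rc (O1 O2 : 'M[R]_N) : O1 *m O1^T = 1%:M -> O2 *m O2^T = 1%:M ->
    forall j, \sum_i (O1^T *m W *m O2) i j ^+ 2 <= A ^+ 2.
  by move=> *; apply: svd_col_le.
clearbody W; pose K := U^T *m W *m V'; pose L := (U'^T *m W *m V)^T.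
have PT : U' = U *m P by rewrite /P mulmxA HU mul1mx.
have QT : V' = V *m Q by rewrite /Q mulmxA HV mul1mx.
have PT' : U = U' *m P^T by rewrite /P trmx_mul trmxK mulmxA HU' mul1mx.
have QT' : V = V' *m Q^T by rewrite /Q trmx_mul trmxK mulmxA HV' mul1mx.
clearbody P Q.
have Y1 : frob W (U' *m diag_mx t *m V'^T) =
    \sum_i \sum_j t ord0 j * (P i j * K i j).
  rewrite frob_svd exchange_big /=; apply: eq_bigr => j _.
  rewrite {1}PT trmx_mul -!mulmxA [U^T *m _]mulmxA mxE mulr_sumr.
  by apply: eq_bigr => i _; rewrite mxE.
have Y2 : frob W (U' *m diag_mx t *m V'^T) =
    \sum_i \sum_j t ord0 j * (Q i j * L i j).
  rewrite frob_svd exchange_big /=; apply: eq_bigr => j _.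
  rewrite {1}QT mulmxA mxE mulr_sumr.
  by apply: eq_bigr => i _; rewrite [L _ _]mxE; ring.
have X1 : frob W (U *m diag_mx s *m V^T) =
    \sum_i \sum_j s ord0 i * (Q i j * K i j).
  rewrite frob_svd; apply: eq_bigr => i _.
  rewrite {1}QT' mulmxA mxE mulr_sumr.
  by apply: eq_bigr => j _; rewrite [Q^T _ _]mxE; ring.
have X2 : frob W (U *m diag_mx s *m V^T) =
    \sum_i \sum_j s ord0 i * (P i j * L i j).
  rewrite frob_svd; apply: eq_bigr => i _.
  rewrite {1}PT' trmx_mul trmxK -!mulmxA [U'^T *m _]mulmxA mxE mulr_sumr.
  by apply: eq_bigr => j _; rewrite [L _ _]mxE.
(* Averaging the two expansions of each term pairs [t_j - s_i] with
   [(P + Q) / 2] and [t_j + s_i] with [(P - Q) / 2]. *)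
have -> : frob W (U' *m diag_mx t *m V'^T - U *m diag_mx s *m V^T) =
  \sum_i \sum_j ((K i j + L i j) / 2 *
       ((P i j + Q i j) / 2 * (1 * t ord0 j - s ord0 i))
   + (L i j - K i j) / 2 * ((P i j - Q i j) / 2 * (- 1 * t ord0 j - s ord0 i))).
  rewrite frobBr; set a := frob _ _; set b := frob _ _.
  transitivity (2^-1 * (a + a - (b + b))); first by field.
  rewrite {1}/a Y1 /a Y2 {1}/b X1 /b X2 -!big_split -sumrB /= mulr_sumr.
  apply: eq_bigr => i _; rewrite -!big_split -sumrB /= mulr_sumr.
  by apply: eq_bigr => j _; field.
have KL : \sum_i \sum_j (w i + w' j) * (K i j ^+ 2 + L i j ^+ 2) <=
   2 * A ^+ 2 * (\sum_i w i + \sum_j w' j).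
  have Kr i : \sum_j K i j ^+ 2 <= A ^+ 2 by apply: Rr.
  have Kc j : \sum_i K i j ^+ 2 <= A ^+ 2 by apply: Rc.
  have Lr i : \sum_j L i j ^+ 2 <= A ^+ 2.
    by rewrite /L; under eq_bigr do rewrite mxE; apply: Rc.
  have Lc j : \sum_i L i j ^+ 2 <= A ^+ 2.
    by rewrite /L; under eq_bigr do rewrite mxE; apply: Rr.
  have -> : \sum_i \sum_j (w i + w' j) * (K i j ^+ 2 + L i j ^+ 2) =
     \sum_i w i * (\sum_j K i j ^+ 2 + \sum_j L i j ^+ 2)
     + \sum_j w' j * (\sum_i K i j ^+ 2 + \sum_i L i j ^+ 2).
    have -> : \sum_j w' j * (\sum_i K i j ^+ 2 + \sum_i L i j ^+ 2) =
       \sum_i \sum_j w' j * (K i j ^+ 2 + L i j ^+ 2).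
      rewrite exchange_big /=; apply: eq_bigr => j _.
      by rewrite -big_split mulr_sumr.
    rewrite -big_split; apply: eq_bigr => i _ /=.
    rewrite -big_split mulr_sumr -big_split; apply: eq_bigr => j _ /=; ring.
  rewrite mulrDr !mulr_sumr; apply: lerD; apply: ler_sum => i _.
    by rewrite mulrC ler_wpM2r // mulr_natl mulr2n lerD.
  by rewrite mulrC ler_wpM2r // mulr_natl mulr2n lerD.
apply: (@le_trans _ _ (\sum_i \sum_j (
   (al * (((P i j + Q i j) / 2) ^+ 2 * F 1 i j)
     + (w i + w' j) * ((K i j + L i j) / 2) ^+ 2 / (2 * al))
 + (al * (((P i j - Q i j) / 2) ^+ 2 * F (- 1) i j)
     + (w i + w' j) * ((L i j - K i j) / 2) ^+ 2 / (2 * al))))).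
  apply: ler_sum => i _; apply: ler_sum => j _; apply: lerD;
    (apply: young_weighted => //;
      [by rewrite addr_ge0|by rewrite mulr_ge0 ?sqr_ge0|
       by rewrite exprMn [leRHS]mulrCA ler_wpM2l ?sqr_ge0]).
have -> : al * mixed_sum P Q F + A ^+ 2 * (\sum_i w i + \sum_j w' j) / (2 * al) =
   al * mixed_sum P Q F + 2 * A ^+ 2 * (\sum_i w i + \sum_j w' j) / (4 * al).
  by field; rewrite gt_eqF.
apply: (@le_trans _ _ (al * mixed_sum P Q F +
   (\sum_i \sum_j (w i + w' j) * (K i j ^+ 2 + L i j ^+ 2)) / (4 * al))); last first.
  by rewrite lerD2l ler_wpM2r // invr_ge0; lra.
rewrite /mixed_sum mulr_sumr mulr_suml -big_split /=; apply: ler_sum => i _.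
rewrite mulr_sumr mulr_suml -big_split /=; apply: ler_sum => j _.
rewrite le_eqVlt; apply/orP; left; apply/eqP; field; rewrite gt_eqF //.
Qed.

End Stability.
End SpectralIdentities.
(** * The scalar potential and its Bregman divergence *)

Section EntropyPotential.
Variable R : realType.

Lemma ln_le_subr1 (x : R) : 0 < x -> ln x <= x - 1.
Proof.
by move=> x0; have := @le_ln1Dx R (x - 1); rewrite addrCA subrr addr0; apply; lra.
Qed.

Lemma ln_sub_le (x y : R) : 0 < x -> 0 < y -> ln x - ln y <= x / y - 1.
Proof.
by move=> x0 y0; rewrite -ln_div ?posrE // ln_le_subr1 // divr_gt0.
Qed.

(** Relative entropy dominates the squared Hellinger distance: apply [ln z <=
    z - 1] to the square root of [C / B]; then [B - C = (sqrt B - sqrt C)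
    (sqrt B + sqrt C)] and [(sqrt B + sqrt C)^2 <= 2 (B + C)]. *)
Lemma kl_lower (B C : R) : 0 < B -> 0 < C ->
  (B - C) ^+ 2 <= 2 * (B + C) * (B * (ln B - ln C) - (B - C)).
Proof.
move=> B0 C0.
have p0 : 0 < Num.sqrt B by rewrite sqrtr_gt0.
have q0 : 0 < Num.sqrt C by rewrite sqrtr_gt0.
move: (Num.sqrt B) (Num.sqrt C) p0 q0 (sqr_sqrtr (ltW B0)) (sqr_sqrtr (ltW C0)).
move=> p q p0 q0 <- <-; rewrite !lnXn // !mulr2n.
have H := ln_sub_le q0 p0.
have {}H : p * (ln p - ln q) >= p - q.
  have -> : p - q = p * - (q / p - 1) by field; rewrite gt_eqF.
  by rewrite ler_wpM2l ?(ltW p0) //; lra.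
have H2 : (p - q) ^+ 2 <=
    p ^+ 2 * (ln p + ln p - (ln q + ln q)) - (p ^+ 2 - q ^+ 2) by nra.
have -> : (p ^+ 2 - q ^+ 2) ^+ 2 = (p + q) ^+ 2 * (p - q) ^+ 2 by ring.
apply: ler_pM; rewrite ?sqr_ge0 //.
by rewrite -subr_ge0 (_ : _ - _ = (p - q) ^+ 2) ?sqr_ge0 //; ring.
Qed.

Lemma kl_upper (B C : R) : 0 < B -> 0 < C ->
  B * (ln B - ln C) - (B - C) <= (B - C) ^+ 2 / C.
Proof.
move=> B0 C0; have H := ln_sub_le B0 C0.
have -> : (B - C) ^+ 2 / C = B * (B / C - 1) - (B - C).
  by field; rewrite gt_eqF.
by rewrite lerD2r ler_wpM2l // ltW.
Qed.

Variable b : R.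
Implicit Types v s : R.

Definition ent (v : R) : R := (`|v| + b) * ln (`|v| / b + 1) - `|v|.
(** The derivative of [ent] on the nonnegative half-line, where the singular
    values live. *)
Definition dent (v : R) : R := ln (v / b + 1).
Definition ent_bregman (v s : R) : R := ent v - ent s - dent s * (v - s).

Lemma entN v : ent (- v) = ent v.
Proof. by rewrite /ent normrN. Qed.

Lemma ent0 : ent 0 = 0.
Proof. by rewrite /ent normr0 mul0r !add0r ln1 mulr0 subr0. Qed.

Lemma dent0 : dent 0 = 0.
Proof. by rewrite /dent mul0r !add0r ln1. Qed.

Lemma dentE v : 0 < b -> 0 <= v -> dent v = ln (v + b) - ln b.
Proof.
move=> b0 v0; have vb : 0 < v + b by rewrite ltr_wpDl.
by rewrite /dent -ln_div ?posrE //; congr ln; field; rewrite gt_eqF.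
Qed.

Lemma dent_ge0 v : 0 < b -> 0 <= v -> 0 <= dent v.
Proof. by move=> b0 v0; rewrite ln_ge0 // lerDr divr_ge0 // ltW. Qed.

Lemma dent_ge v : 0 < b -> 0 <= v -> v <= (v + b) * dent v.
Proof.
move=> b0 v0; rewrite dentE //.
have vb : 0 < v + b by lra.
have H := ln_sub_le b0 vb.
have : (v + b) * (ln b - ln (v + b)) <= (v + b) * (b / (v + b) - 1).
  by rewrite ler_wpM2l // ltW.
have -> : (v + b) * (b / (v + b) - 1) = - v by field; rewrite gt_eqF.
by lra.
Qed.

Lemma dent_le v : 0 < b -> 0 <= v -> dent v <= v / b.
Proof.
move=> b0 v0; have := @ln_le_subr1 (v / b + 1); rewrite addrK; apply.
by rewrite ltr_wpDl // divr_ge0 // ltW.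
Qed.

Lemma entE v : 0 < b -> 0 <= v -> ent v = (v + b) * (ln (v + b) - ln b) - v.
Proof. by move=> b0 v0; rewrite -dentE // /ent ger0_norm. Qed.

(** On nonnegative arguments the divergence is the relative entropy of the
    numbers shifted by [b]. *)
Lemma ent_bregmanE v s : 0 < b -> 0 <= v -> 0 <= s -> ent_bregman v s =
  (v + b) * (ln (v + b) - ln (s + b)) - ((v + b) - (s + b)).
Proof. by move=> b0 v0 s0; rewrite /ent_bregman !entE // dentE //; ring. Qed.

Lemma ent_bregmanN v s : ent_bregman (- v) s = ent_bregman v s + 2 * v * dent s.
Proof. by rewrite /ent_bregman entN; ring. Qed.

Lemma ent_bregman_lower_pos v s : 0 < b -> 0 <= v -> 0 <= s ->
  (v - s) ^+ 2 <= 2 * (v + s + 2 * b) * ent_bregman v s.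
Proof.
move=> b0 v0 s0; rewrite ent_bregmanE //.
have := @kl_lower (v + b) (s + b).
rewrite (_ : v + b - (s + b) = v - s); last by ring.
rewrite (_ : v + b + (s + b) = v + s + 2 * b); last by ring.
by apply; lra.
Qed.

(** Moving from [v] to [- v] increases the square by [4 v s] and the
    divergence by [2 v dent s], and [s <= (s + b) dent s] makes the latter
    sufficient. *)
Lemma ent_bregman_lower_neg v s : 0 < b -> 0 <= v -> 0 <= s ->
  (- v - s) ^+ 2 <= 2 * (v + s + 2 * b) * ent_bregman (- v) s.
Proof.
move=> b0 v0 s0; rewrite ent_bregmanN.
have H1 := ent_bregman_lower_pos b0 v0 s0.
have H2 := dent_ge b0 s0; have H3 := dent_ge0 b0 s0.
have H4 : s <= (v + s + 2 * b) * dent s.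
  by apply: le_trans H2 _; rewrite ler_wpM2r //; lra.
have H5 : v * s <= v * ((v + s + 2 * b) * dent s) by rewrite ler_wpM2l.
have -> : (- v - s) ^+ 2 = (v - s) ^+ 2 + 4 * (v * s) by ring.
have -> : 2 * (v + s + 2 * b) * (ent_bregman v s + 2 * v * dent s) =
  2 * (v + s + 2 * b) * ent_bregman v s + 4 * (v * ((v + s + 2 * b) * dent s)).
  by ring.
by lra.
Qed.

Lemma ent_bregman_upper_pos v s : 0 < b -> 0 <= v -> 0 <= s ->
  ent_bregman v s <= (v - s) ^+ 2 / b.
Proof.
move=> b0 v0 s0; rewrite ent_bregmanE //.
have vb : 0 < v + b by lra.
have sb : 0 < s + b by lra.
apply: le_trans (kl_upper vb sb) _.
rewrite (_ : v + b - (s + b) = v - s); last by ring.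
by rewrite ler_wpM2l ?sqr_ge0 // lef_pV2 ?posrE //; lra.
Qed.

Lemma ent_bregman_upper_neg v s : 0 < b -> 0 <= v -> 0 <= s ->
  ent_bregman (- v) s <= (- v - s) ^+ 2 / b.
Proof.
move=> b0 v0 s0; rewrite ent_bregmanN.
have H1 := ent_bregman_upper_pos b0 v0 s0.
have H2 : v * dent s <= v * (s / b) by rewrite ler_wpM2l // dent_le.
have H3 : 0 <= v * (s / b) by rewrite mulr_ge0 // divr_ge0 // ltW.
have -> : (- v - s) ^+ 2 / b = (v - s) ^+ 2 / b + 4 * (v * (s / b)).
  by field; rewrite gt_eqF.
by lra.
Qed.

Lemma ent_bregman_ge0_pos v s : 0 < b -> 0 <= v -> 0 <= s ->
  0 <= ent_bregman v s.
Proof.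
move=> b0 v0 s0; have H := le_trans (sqr_ge0 _) (ent_bregman_lower_pos b0 v0 s0).
by move: H; rewrite pmulr_rge0 //; lra.
Qed.

Lemma ent_bregman_ge0_neg v s : 0 < b -> 0 <= v -> 0 <= s ->
  0 <= ent_bregman (- v) s.
Proof.
move=> b0 v0 s0; have H := le_trans (sqr_ge0 _) (ent_bregman_lower_neg b0 v0 s0).
by move: H; rewrite pmulr_rge0 //; lra.
Qed.

(** The left-hand side is the convex conjugate of [ent] at the slope [dent v];
    it equals [v - b * dent v]. *)
Lemma ent_dual_le v : 0 < b -> 0 <= v -> v * dent v - ent v <= v.
Proof.
move=> b0 v0; rewrite entE // -dentE //.
have := mulr_ge0 (ltW b0) (dent_ge0 b0 v0).
by lra.
Qed.

End EntropyPotential.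
(** * Existence of singular value decompositions *)

Section SingularValueDecomposition.
Variable R : realType.

(** The reflection exchanging the first basis vector and [u]. *)
Lemma householder n (u : 'cV[R]_n.+1) : frob u u = 1 ->
  exists H : 'M[R]_n.+1, H *m H^T = 1%:M /\ H *m delta_mx ord0 ord0 = u.
Proof.
move=> u1; pose e : 'cV[R]_n.+1 := delta_mx ord0 ord0.
have e1 : frob e e = 1 by rewrite frob_delta mxE eqxx.
have [->|ue] := eqVneq u e; first by exists 1%:M; rewrite trmx1 !mul1mx.
have [w wE] : exists w, w = u - e by exists (u - e).
pose c := 2 / frob w w.
have w0 : frob w w != 0.
  by rewrite wE; apply: contra ue => /eqP/frob_eq0/eqP; rewrite subr_eq0.
have fE (x y : 'cV[R]_n.+1) : x^T *m y = (frob x y)%:M.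
  by rewrite /frob trace_mx11 -mx11_scalar.
have wwT : w *m w^T *m (w *m w^T) = frob w w *: (w *m w^T).
  by rewrite mulmxA -(mulmxA w) fE mul_mx_scalar -scalemxAl.
exists (1%:M - c *: (w *m w^T)); split.
  rewrite linearB /= trmx1 [(_ *: _)^T]linearZ /= trmx_mul trmxK.
  rewrite mulmxBl mul1mx mulmxBr mulmx1 -scalemxAl -scalemxAr wwT !scalerA.
  have -> : c * c * frob w w = c + c by rewrite /c; field.
  by rewrite scalerDl opprB addrK subrK.
rewrite -/e mulmxBl mul1mx -scalemxAl -mulmxA fE mul_mx_scalar scalerA.
have -> : c * frob w e = - 1.
  move: w0; rewrite /c.
  have -> : frob w w = - (2 * frob w e).
    rewrite wE !frobBr !frobBl u1 e1 (frobC e u); ring.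
  rewrite oppr_eq0 mulf_eq0 negb_or => /andP[_ we].
  by field.
by rewrite scaleN1r opprK wE addrC subrK.
Qed.

Lemma sum_continuous n (I : Type) (r : seq I) (F : I -> 'rV[R]_n -> R) :
  (forall i, continuous (F i)) -> continuous (fun v => \sum_(i <- r) F i v).
Proof.
move=> cF; elim: r => [|i r IH].
  rewrite (_ : (fun _ => _) = cst 0); first exact: cst_continuous.
  by apply/funext => v; rewrite big_nil.
rewrite (_ : (fun _ => _) = (fun v => F i v + \sum_(j <- r) F j v)).
  by move=> v; apply: (@continuousD _ _ _ (F i)); [exact: (cF i v)|exact: (IH v)].
by apply/funext => v; rewrite big_cons.
Qed.

Lemma sqr_continuous n (F : 'rV[R]_n -> R) : continuous F ->
  continuous (fun v => F v * F v).
Proof. by move=> cF v; apply: continuousM; exact: (cF v). Qed.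

Lemma frob_mul_continuous n p (M : 'M[R]_(n, p)) :
  continuous (fun w : 'rV[R]_n => frob (w *m M) (w *m M)).
Proof.
under eq_fun do rewrite frobE big_ord1.
apply: sum_continuous => j; apply: sqr_continuous.
under eq_fun do rewrite mxE.
apply: sum_continuous => i v; apply: continuousM; last exact: cst_continuous.
exact: coord_continuous.
Qed.

Definition opnorm_le m n (X : 'M[R]_(m, n)) (a : R) : Prop :=
  forall y : 'cV[R]_n, frob (X *m y) (X *m y) <= a ^+ 2 * frob y y.

Lemma frob_trmx m n (x y : 'M[R]_(m, n)) : frob x^T y^T = frob x y.
Proof. by rewrite /frob trmxK mxtrace_mulC -mxtrace_tr trmx_mul trmxK. Qed.

Lemma sphere_compact n : compact [set w : 'rV[R]_n | frob w w = 1].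
Proof.
have cl : closed [set w : 'rV[R]_n | frob w w = 1].
  apply: (@preimage_closed _ _ (fun w : 'rV[R]_n => frob w w) [set x | x = 1]).
    have := @frob_mul_continuous n n 1%:M.
    by under eq_fun do rewrite mulmx1; move=> cf w _; exact: cf.
  exact: closed_eq.
have co := @rV_compact R n (fun=> `[-1, 1]%classic)
  (fun=> @segment_compact R (-1) 1).
apply: subclosed_compact cl co _ => w /= w1 i.
have : w ord0 i ^+ 2 <= 1.
  rewrite -w1 frobE big_ord1 (bigD1 i) //= -expr2 lerDl sumr_ge0 // => j _.
  by rewrite -expr2 sqr_ge0.
by rewrite /= in_itv /= -ler_norml -sqrtr_sqr => /ler_wsqrtr; rewrite sqrtr1.
Qed.

(** A maximiser of [|X v|] on the unit sphere, which is compact. *)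
Lemma top_right_singular_vector m n (X : 'M[R]_(m, n.+1)) :
  exists (a : R) (v : 'cV[R]_n.+1),
  [/\ 0 <= a, frob v v = 1, frob (X *m v) (X *m v) = a ^+ 2 & opnorm_le X a].
Proof.
pose f (w : 'rV[R]_n.+1) := frob (w *m X^T) (w *m X^T).
pose S := [set w : 'rV[R]_n.+1 | frob w w = 1].
have S0 : S !=set0 by exists (delta_mx ord0 ord0); rewrite /S /= frob_delta mxE eqxx.
have [c cS cmax] := EVT_max_rV S0 (@sphere_compact n.+1)
  (continuous_subspaceT (@frob_mul_continuous _ _ X^T)).
have fc : 0 <= f c by exact: frob_ge0.
have XT (y : 'cV[R]_n.+1) : frob (X *m y) (X *m y) = f y^T.
  by rewrite /f -trmx_mul frob_trmx.
exists (Num.sqrt (f c)), c^T; split; rewrite ?sqrtr_ge0 ?frob_trmx //.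
- by move/set_mem : cS.
- by rewrite sqr_sqrtr // XT trmxK.
move=> y; rewrite sqr_sqrtr // XT.
have [y0|y0] := eqVneq (frob y y) 0.
  by rewrite y0 (frob_eq0 y0) mulr0 /f trmx0 mul0mx frob0r.
have yp : 0 < frob y y by rewrite lt_def y0 frob_ge0.
pose k := (Num.sqrt (frob y y))^-1.
have k2 : k ^+ 2 = (frob y y)^-1 by rewrite exprVn sqr_sqrtr // ltW.
have fk : f (k *: y^T) = k ^+ 2 * f y^T.
  by rewrite /f -scalemxAl frobZl frobZr mulrA expr2.
have /cmax : (k *: y^T) \in S.
  by rewrite inE /S /= frobZl frobZr frob_trmx mulrA -expr2 k2 mulVf.
by rewrite -/(f _) -/(f c) fk k2 mulrC ler_pdivrMr.
Qed.

(** With [u = X v / a], the vector [X^T u] has norm at most [a] and inner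
    product [a] with the unit vector [v], hence equals [a v]. *)
Lemma top_singular_pair m n (X : 'M[R]_(m.+1, n.+1)) :
  exists (a : R) (u : 'cV[R]_m.+1) (v : 'cV[R]_n.+1),
  [/\ 0 <= a, frob u u = 1 /\ frob v v = 1, X *m v = a *: u, X^T *m u = a *: v &
      opnorm_le X a].
Proof.
have [a [v [a0 v1 Xv Xle]]] := top_right_singular_vector X.
have [a00|an0] := eqVneq a 0.
  have X0 : X = 0.
    apply/matrixP => i j; have := Xle (delta_mx j ord0).
    rewrite a00 expr0n mul0r => H.
    have /frob_eq0/matrixP/(_ i ord0) : frob (X *m (delta_mx j ord0 : 'cV_n.+1))
      (X *m delta_mx j ord0) = 0 by apply/le_anti; rewrite H frob_ge0.
    by rewrite -colE !mxE.
  exists 0, (delta_mx ord0 ord0), v; split => //.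
  - by rewrite frob_delta mxE eqxx.
  - by rewrite X0 mul0mx scale0r.
  - by rewrite X0 trmx0 mul0mx scale0r.
  - by rewrite -a00.
have ap : 0 < a by rewrite lt_def an0.
pose u := a^-1 *: (X *m v).
have u1 : frob u u = 1 by rewrite frobZl frobZr Xv; field.
have Xvu : X *m v = a *: u by rewrite scalerA mulfV // scale1r.
clearbody u; exists a, u, v; split => //.
set w := X^T *m u.
have wv : frob w v = a by rewrite frob_mulmxA trmxK Xvu frobZr u1 mulr1.
have ww : frob w w = frob u (X *m w).
  by rewrite {1}/w frob_mulmxA trmxK.
clearbody w.
(* From the nonnegative square [|a^2 u - X w|^2]. *)
have wa : frob w w <= a ^+ 2.
  have := frob_ge0 (a ^+ 2 *: u - X *m w).
  rewrite !frobBr !frobBl !frobZl !frobZr (frobC (X *m w) u) u1 -ww => H.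
  have H2 := Xle w.
  have a2 : 0 < a ^+ 2 by rewrite exprn_gt0.
  rewrite -subr_ge0 -(pmulr_rge0 _ a2); lra.
apply/eqP; rewrite -subr_eq0; apply/eqP/frob_eq0/le_anti; rewrite frob_ge0 andbT.
rewrite !frobBr !frobBl !frobZl !frobZr (frobC v w) wv v1; lra.
Qed.

(** Diagonals indexed by [nat] spare the induction on both dimensions any cast
    along [minn m.+1 n.+1 = (minn m n).+1]. *)
Definition diagonal_mx m n (s : nat -> R) : 'M[R]_(m, n) :=
  \matrix_(i, j) (s i *+ (i == j :> nat)).

(** Induction on the dimensions: Householder reflections moving the top
    singular pair to the first basis vectors make [X] block diagonal. The
    bound of the leading singular value by every operator norm bound is what
    keeps the singular values sorted when the top one is put in front. *)
Theorem svd_exists m n (X : 'M[R]_(m, n)) :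
  exists (U : 'M[R]_m) (V : 'M[R]_n) (s : nat -> R),
  [/\ U *m U^T = 1%:M, V *m V^T = 1%:M, forall k, 0 <= s k /\ s k.+1 <= s k,
      forall a : R, 0 <= a -> opnorm_le X a -> s 0%N <= a &
      X = U *m diagonal_mx m n s *m V^T].
Proof.
elim: m n X => [|m IH] n X.
  exists 1%:M, 1%:M, (fun=> 0); split; rewrite ?trmx1 ?mulmx1 //.
  by apply/matrixP => -[].
case: n X => [|n] X.
  exists 1%:M, 1%:M, (fun=> 0); split; rewrite ?trmx1 ?mulmx1 //.
  by apply/matrixP => i -[].
have [a [u [v [a0 [u1 v1] Xv XTu Xle]]]] := top_singular_pair X.
have [H1 [H1o H1u]] := householder u1.
have [H2 [H2o H2v]] := householder v1.
pose M : 'M[R]_(1 + m, 1 + n) := H1^T *m X *m H2.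
have XM : X = H1 *m M *m H2^T.
  by rewrite /M !mulmxA H1o mul1mx -mulmxA H2o mulmx1.
have Mcol : M *m delta_mx ord0 (ord0 : 'I_1) = a *: delta_mx ord0 ord0.
  rewrite /M -!mulmxA H2v Xv -scalemxAr -H1u mulmxA.
  by rewrite (mulmx1C H1o) mul1mx.
have Mrow : M^T *m delta_mx ord0 (ord0 : 'I_1) = a *: delta_mx ord0 ord0.
  rewrite /M !trmx_mul trmxK -!mulmxA H1u XTu -scalemxAr -H2v mulmxA.
  by rewrite (mulmx1C H2o) mul1mx.
have MX : M = H1^T *m X *m H2 by [].
clearbody M.
have ME : M = block_mx a%:M 0 0 (drsubmx M).
  rewrite -[LHS]submxK; congr block_mx; apply/matrixP => i j; rewrite !ord1 !mxE.
  - have /matrixP/(_ ord0 ord0) := Mcol; rewrite -colE !mxE !eqxx mulr1 mulr1n => <-.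
    by congr (fun_of_matrix M _ _); apply: val_inj.
  - have /matrixP/(_ (rshift 1 j) ord0) := Mrow.
    rewrite -colE !mxE mulr0 => <-.
    by congr (fun_of_matrix M _ _); apply: val_inj.
  - have /matrixP/(_ (rshift 1 i) ord0) := Mcol.
    rewrite -colE !mxE mulr0 => <-.
    by congr (fun_of_matrix M _ _); apply: val_inj.
move: (drsubmx M) ME => B ME.
have [U' [V' [s' [U'o V'o s'd s'0 XE]]]] := IH n B.
have sub_le : opnorm_le B a.
  move=> y; pose z : 'cV[R]_(1 + n) := col_mx 0 y.
  have frob_col p q (x1 : 'cV[R]_p) (x2 : 'cV[R]_q) :
      frob (col_mx x1 x2) (col_mx x1 x2) = frob x1 x1 + frob x2 x2.
    by rewrite /frob tr_col_mx mul_row_col mxtraceD.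
  have zz : frob (H2 *m z) (H2 *m z) = frob y y.
    by rewrite frob_mulmxA mulmxA (mulmx1C H2o) mul1mx (frob_col 1%N n) frob0r add0r.
  have Mz : frob (M *m z) (M *m z) = frob (X *m (H2 *m z)) (X *m (H2 *m z)).
    rewrite MX -!mulmxA frob_mulmxA trmxK (mulmxA H1) H1o mul1mx.
    by rewrite !mulmxA.
  have := Xle (H2 *m z); rewrite -Mz zz ME /z mul_block_col frob_col.
  rewrite !mul0mx mulmx0 !add0r; apply: le_trans.
  by rewrite lerDr frob_ge0.
pose s k := if k is k'.+1 then s' k' else a.
pose U1 : 'M[R]_(1 + m) := block_mx 1%:M 0 0 U'.
pose V1 : 'M[R]_(1 + n) := block_mx 1%:M 0 0 V'.
have U1o : U1 *m U1^T = 1%:M.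
  rewrite tr_block_mx mulmx_block.
  rewrite !trmx0 !trmx1 !mulmx0 !mul0mx !mulmx1 !addr0 !add0r U'o.
  by rewrite -scalar_mx_block.
have V1o : V1 *m V1^T = 1%:M.
  rewrite tr_block_mx mulmx_block.
  rewrite !trmx0 !trmx1 !mulmx0 !mul0mx !mulmx1 !addr0 !add0r V'o.
  by rewrite -scalar_mx_block.
exists (H1 *m U1), (H2 *m V1), s; split.
- by rewrite trmx_mul mulmxA -(mulmxA H1) U1o mulmx1.
- by rewrite trmx_mul mulmxA -(mulmxA H2) V1o mulmx1.
- by case=> [|k]; [rewrite a0; split => //; exact: s'0|exact: s'd].
- move=> c c0 Xc; rewrite /s -ler_sqr ?nnegrE //.
  have := Xc v; rewrite Xv frobZl frobZr u1 v1 !mulr1.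
  by rewrite -expr2.
rewrite XM ME XE.
have DE : diagonal_mx (1 + m) (1 + n) s =
    block_mx a%:M 0 0 (diagonal_mx m n s').
  rewrite -[LHS]submxK; congr block_mx; apply/matrixP => i j;
    by rewrite !mxE ?ord1.
rewrite -[diagonal_mx m.+1 n.+1 s]/(diagonal_mx (1 + m) (1 + n) s) DE.
have -> : block_mx a%:M 0 0 (U' *m diagonal_mx m n s' *m V'^T) =
    U1 *m block_mx a%:M 0 0 (diagonal_mx m n s') *m V1^T.
  rewrite tr_block_mx !mulmx_block.
  rewrite !trmx0 !trmx1 !(mulmx0, mul0mx) !(mulmx1, mul1mx) !(addr0, add0r).
  by rewrite !(mulmx0, mul0mx).
by rewrite trmx_mul !mulmxA.
Qed.

End SingularValueDecomposition.
(** * Padding rectangular matrices to square ones *)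

Section ZeroPadding.
Variables (R : realType) (N : nat).

Definition coords d (s : 'rV[R]_d) (k : nat) : R := oapp (s ord0) 0 (insub k).

Definition pad_row d (s : 'rV[R]_d) : 'rV[R]_N := \row_(k < N) coords s k.

Definition pad_mx m n (A : 'M[R]_(m, n)) : 'M[R]_N :=
  (pid_mx m : 'M[R]_(N, m)) *m A *m (pid_mx n : 'M[R]_(n, N)).

(** Completing by the identity makes the padded matrix orthogonal again. *)
Definition pad_ortho m (U : 'M[R]_m) : 'M[R]_N :=
  pad_mx U + (1%:M - pid_mx m).

Lemma coords_ord d (s : 'rV[R]_d) (k : 'I_d) : coords s k = s ord0 k.
Proof. by rewrite /coords valK. Qed.

Lemma coords_out d (s : 'rV[R]_d) k : (d <= k)%N -> coords s k = 0.
Proof. by move=> dk; rewrite /coords insubF // ltnNge dk. Qed.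

Lemma coords_ge0 d (s : 'rV[R]_d) k : (forall i, 0 <= s ord0 i) -> 0 <= coords s k.
Proof. by move=> s0; rewrite /coords; case: insub => /=. Qed.

Lemma coords_map (f : R -> R) d (s : 'rV[R]_d) k : f 0 = 0 ->
  coords (map_mx f s) k = f (coords s k).
Proof. by move=> f0; rewrite /coords; case: insub => //= i; rewrite mxE. Qed.

Lemma rect_diagE m n (s : 'rV[R]_(minn m n)) :
  rect_diag s = diagonal_mx m n (coords s).
Proof.
apply/matrixP => i j; rewrite !mxE.
have [ij|ij] := eqVneq (i : nat) (j : nat); last first.
  rewrite big1 // => k _; case: eqP => //= ik; case: eqP => //= jk.
  by move: ij; rewrite ik jk eqxx.
have id : (i < minn m n)%N by rewrite leq_min ltn_ord ij ltn_ord.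
rewrite mulr1n (bigD1 (Ordinal id)) //= eqxx -ij eqxx mulr1n big1 ?addr0.
  by rewrite -(coords_ord s (Ordinal id)).
move=> k ki; case: eqP => //= ik; move: ki.
by rewrite -(inj_eq val_inj) /= ik eqxx.
Qed.

Lemma sum_pad_row d (s : 'rV[R]_d) (F : R -> R) : (d <= N)%N -> F 0 = 0 ->
  \sum_k F (pad_row s ord0 k) = \sum_k F (s ord0 k).
Proof.
move=> dN F0.
under eq_bigr do rewrite mxE.
under [RHS]eq_bigr do rewrite -coords_ord.
rewrite [RHS](big_ord_widen N (fun k => F (coords s k))) // [RHS]big_mkcond /=.
by apply: eq_bigr => k _; case: ltnP => // dk; rewrite coords_out.
Qed.

Lemma sum_pad_support d (c : R) : (d <= N)%N ->
  \sum_(k < N) (if (k < d)%N then c else 0) = d%:R * c.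
Proof.
move=> dN; rewrite -big_mkcond /= -(big_ord_widen N (fun=> c)) //.
by rewrite big_const_ord iter_addr_0 mulr_natl.
Qed.

Lemma pad_mxB m n (A B : 'M[R]_(m, n)) : pad_mx (A - B) = pad_mx A - pad_mx B.
Proof. by rewrite /pad_mx mulmxBr mulmxBl. Qed.

Lemma pid_mx_trK m : (m <= N)%N ->
  (pid_mx m : 'M[R]_(N, m))^T *m (pid_mx m : 'M[R]_(N, m)) = 1%:M.
Proof. by move=> mN; rewrite tr_pid_mx pid_mx_id // pid_mx_1. Qed.

Lemma frob_pad m n (A B : 'M[R]_(m, n)) : (m <= N)%N -> (n <= N)%N ->
  frob (pad_mx A) (pad_mx B) = frob A B.
Proof.
move=> mN nN; rewrite /pad_mx frob_mulmxAr -!mulmxA.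
have -> : (pid_mx n : 'M[R]_(n, N)) *m (pid_mx n : 'M[R]_(n, N))^T = 1%:M.
  by rewrite tr_pid_mx pid_mx_id // pid_mx_1.
by rewrite mulmx1 frob_mulmxA mulmxA pid_mx_trK // mul1mx.
Qed.

Lemma pad_orthoP m (U : 'M[R]_m) : (m <= N)%N -> U *m U^T = 1%:M ->
  pad_ortho U *m (pad_ortho U)^T = 1%:M.
Proof.
move=> mN HU; rewrite /pad_ortho.
set e : 'M[R]_N := pid_mx m; set p := pad_mx U.
have ee : e *m e = e by rewrite pid_mx_id.
have eT : e^T = e by rewrite tr_pid_mx.
have ep : e *m p = p by rewrite /p /pad_mx !mulmxA pid_mx_id.
have pe : p *m e = p by rewrite /p /pad_mx -!mulmxA pid_mx_id.
have pp : p *m p^T = e.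
  rewrite /p /pad_mx !trmx_mul !tr_pid_mx !mulmxA.
  rewrite -(mulmxA _ (pid_mx m) (pid_mx m)) pid_mx_id // pid_mx_1 mulmx1.
  by rewrite -(mulmxA _ U) HU mulmx1 pid_mx_id.
have pTe : e *m p^T = p^T by rewrite -{1}eT -trmx_mul pe.
rewrite linearD /= linearB /= trmx1 eT.
rewrite mulmxDl !mulmxDr !mulmxBl !mulmxN !mul1mx !mulmx1 pp pe ee pTe.
by rewrite !subrr !addr0 add0r addrC subrK.
Qed.

Lemma pid_mulmxE m p (A : 'M[R]_(m, p)) (f : nat -> R) (i : 'I_N) j :
  (forall k, A k j = f k) ->
  ((pid_mx m : 'M[R]_(N, m)) *m A) i j = if (i < m)%N then f i else 0.
Proof.
move=> Af; rewrite mxE; case: ltnP => im; last first.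
  by rewrite big1 // => k _; rewrite mxE ltnNge im andbF mul0r.
rewrite (bigD1 (Ordinal im)) //= mxE eqxx im mul1r Af big1 ?addr0 //.
move=> k; rewrite -(inj_eq val_inj) /= eq_sym => /negbTE ki.
by rewrite mxE ki mul0r.
Qed.

Lemma mulmx_pidE n p (A : 'M[R]_(p, n)) (f : nat -> R) i (j : 'I_N) :
  (forall k, A i k = f k) ->
  (A *m (pid_mx n : 'M[R]_(n, N))) i j = if (j < n)%N then f j else 0.
Proof.
move=> Af; rewrite -[A *m _]trmxK trmx_mul tr_pid_mx [LHS]mxE.
by apply: pid_mulmxE => k; rewrite mxE.
Qed.

(** The identity block of [pad_ortho] only meets zero entries of the padded
    diagonal. *)
Lemma pad_svd m n (U : 'M[R]_m) (s : 'rV[R]_(minn m n)) (V : 'M[R]_n) :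
  (m <= N)%N -> (n <= N)%N ->
  pad_mx (U *m rect_diag s *m V^T) =
  pad_ortho U *m diag_mx (pad_row s) *m (pad_ortho V)^T.
Proof.
have shift p (O : 'M[R]_p) : (p <= N)%N ->
    pad_ortho O *m (pid_mx p : 'M[R]_(N, p)) = (pid_mx p : 'M[R]_(N, p)) *m O.
  move=> pN; rewrite /pad_ortho mulmxDl mulmxBl mul1mx.
  rewrite pid_mx_id // subrr addr0 /pad_mx -mulmxA pid_mx_id // pid_mx_1.
  by rewrite mulmx1.
move=> mN nN.
have -> : diag_mx (pad_row s) =
    (pid_mx m : 'M[R]_(N, m)) *m rect_diag s *m (pid_mx n : 'M[R]_(n, N)).
  rewrite rect_diagE; apply/matrixP => i j.
  rewrite [LHS]mxE [X in X *+ _]mxE.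
  pose f k := if (i < m)%N then coords s i *+ (i == k :> nat) else 0.
  rewrite (@mulmx_pidE _ _ _ f).
    rewrite /f; have [ij|ij] := eqVneq i j; last first.
      by rewrite -(inj_eq val_inj) in ij; rewrite (negbTE ij) !mulr0n !if_same.
    rewrite -ij eqxx !mulr1n.
    case: (ltnP i m) => im; case: (ltnP i n) => jn //;
      by rewrite coords_out // geq_min ?im ?jn ?orbT.
  move=> k; rewrite (@pid_mulmxE _ _ _ (fun k' => coords s k' *+ (k' == k :> nat))) //.
  by move=> k'; rewrite mxE.
rewrite !mulmxA shift // -(mulmxA _ _ (pad_ortho V)^T).
have -> : (pid_mx n : 'M[R]_(n, N)) *m (pad_ortho V)^T =
   V^T *m (pid_mx n : 'M[R]_(n, N)).
  by rewrite -[LHS]trmxK trmx_mul trmxK tr_pid_mx shift // trmx_mul tr_pid_mx.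
by rewrite /pad_mx !mulmxA.
Qed.

End ZeroPadding.
(** * The spectral potential of a rectangular matrix *)

Section SpectralPotential.
Variables (R : realType) (m n : nat).
Implicit Types X Y W : 'M[R]_(m, n).

Lemma sigmaP X : is_singular_values X (sigma X).
Proof.
rewrite /sigma; case: xgetP => [s _ //|]; move=> /(_ _) H; exfalso.
have [U [V [s [HU HV sd _ XE]]]] := svd_exists X.
have rE : rect_diag (\row_(k < minn m n) s k) = diagonal_mx m n s.
  rewrite rect_diagE; apply/matrixP => i j; rewrite !mxE.
  have [ij|ij] := eqVneq (i : nat) (j : nat); last by rewrite !mulr0n.
  have id : (i < minn m n)%N by rewrite leq_min ltn_ord ij ltn_ord.
  by have := coords_ord (\row_(k < minn m n) s k) (Ordinal id); rewrite mxE => /= ->.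
apply: (H (\row_(k < minn m n) s k)); split.
- by move=> i; rewrite mxE; have [] := sd i.
- move=> i j ij; rewrite !mxE.
  by apply: (@homo_leq _ s (fun x y => y <= x)) => // [x y z yx xz|k];
    [exact: le_trans xz yx|have [] := sd k].
- by exists U, V; rewrite rE.
Qed.

Lemma sigma_ge0 X i : 0 <= sigma X ord0 i.
Proof. by have [] := sigmaP X. Qed.

Lemma sigma_svd X : exists (U : 'M[R]_m) (V : 'M[R]_n),
  [/\ U *m U^T = 1%:M, V *m V^T = 1%:M & X = U *m rect_diag (sigma X) *m V^T].
Proof. by have [] := sigmaP X. Qed.

Lemma spectral_norm_ge0 X : 0 <= spectral_norm X.
Proof.
rewrite /spectral_norm; elim/big_ind: _ => [|a b a0 b0|i _] //.
  by rewrite le_max a0.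
exact: sigma_ge0.
Qed.

Lemma sigma_le_spectral_norm X i : sigma X ord0 i <= spectral_norm X.
Proof. exact: le_bigmax. Qed.

Let N := (m + n)%N.
Let mN : (m <= N)%N. Proof. exact: leq_addr. Qed.
Let nN : (n <= N)%N. Proof. exact: leq_addl. Qed.
Let dN : (minn m n <= N)%N. Proof. by rewrite geq_min mN. Qed.

Lemma sigma_pad X : exists U V : 'M[R]_N,
  [/\ U *m U^T = 1%:M, V *m V^T = 1%:M &
      pad_mx N X = U *m diag_mx (pad_row N (sigma X)) *m V^T].
Proof.
have [U [V [HU HV XE]]] := sigma_svd X.
exists (pad_ortho N U), (pad_ortho N V); split; try exact: pad_orthoP.
by rewrite {1}XE pad_svd.
Qed.

Lemma pad_row_ge0 (s : 'rV[R]_(minn m n)) : (forall i, 0 <= s ord0 i) ->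
  forall k, 0 <= pad_row N s ord0 k.
Proof. by move=> s0 k; rewrite mxE coords_ge0. Qed.

Lemma pad_row_norm_le (s : 'rV[R]_(minn m n)) A : 0 <= A ->
  (forall i, `|s ord0 i| <= A) -> forall k, `|pad_row N s ord0 k| <= A.
Proof.
move=> A0 sA k; rewrite mxE /coords; case: insub => [i|] //=.
by rewrite normr0.
Qed.

Lemma sum_pad_sigma X : \sum_k pad_row N (sigma X) ord0 k = nuclear_norm X.
Proof. exact: (@sum_pad_row R N _ _ id). Qed.

(** The vector [z] need be neither sorted nor nonnegative, so that this covers
    [W], [- W] and the gradients of the potential alike. *)
Lemma frob_le_nuclear (U : 'M[R]_m) (V : 'M[R]_n) (z : 'rV[R]_(minn m n)) A Y :
  U *m U^T = 1%:M -> V *m V^T = 1%:M -> 0 <= A ->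
  (forall i, `|z ord0 i| <= A) ->
  frob (U *m rect_diag z *m V^T) Y <= A * nuclear_norm Y.
Proof.
move=> HU HV A0 zA; have [U' [V' [HU' HV' YE]]] := sigma_pad Y.
rewrite -(@frob_pad R N) // YE pad_svd // -sum_pad_sigma.
apply: svd_holder; rewrite ?pad_orthoP //; first exact: pad_row_norm_le.
by apply: pad_row_ge0; exact: sigma_ge0.
Qed.

Lemma frob_le_spectral_nuclear W Y :
  `|frob W Y| <= spectral_norm W * nuclear_norm Y.
Proof.
have [U [V [HU HV WE]]] := sigma_svd W.
have zA i : `|sigma W ord0 i| <= spectral_norm W.
  by rewrite ger0_norm ?sigma_ge0 // sigma_le_spectral_norm.
have A0 := spectral_norm_ge0 W.
apply/ler_normlP; rewrite -frobNl {1 3}WE -!mulNmx.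
split; apply: frob_le_nuclear => //.
by rewrite linearN /= mulmxN mulNmx opprK.
Qed.

Section Gradient.
Variables (b : R) (U : 'M[R]_m) (V : 'M[R]_n) (X : 'M[R]_(m, n)).
Hypotheses (HU : U *m U^T = 1%:M) (HV : V *m V^T = 1%:M).
Hypothesis XE : X = U *m rect_diag (sigma X) *m V^T.

Definition potential (Y : 'M[R]_(m, n)) : R := \sum_i ent b (sigma Y ord0 i).

Let G := U *m rect_diag (map_mx (dent b) (sigma X)) *m V^T.

Let XP : pad_mx N X =
  pad_ortho N U *m diag_mx (pad_row N (sigma X)) *m (pad_ortho N V)^T.
Proof. by rewrite {1}XE pad_svd. Qed.

(** The identity [svd_bregman] for rectangular matrices: the extra singular
    values created by padding are zero, where both [ent] and [dent] vanish. *)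
Lemma potential_padE Y U' V' :
  U' *m U'^T = 1%:M -> V' *m V'^T = 1%:M ->
  pad_mx N Y = U' *m diag_mx (pad_row N (sigma Y)) *m V'^T ->
  potential Y - potential X - frob G (Y - X) =
  mixed_sum ((pad_ortho N U)^T *m U') ((pad_ortho N V)^T *m V')
   (fun e i j => ent_bregman b (e * pad_row N (sigma Y) ord0 j)
                               (pad_row N (sigma X) ord0 i)).
Proof.
move=> HU' HV' YE; rewrite -(@frob_pad R N) // pad_mxB YE XP pad_svd //.
have -> : pad_row N (map_mx (dent b) (sigma X)) =
    map_mx (dent b) (pad_row N (sigma X)).
  by apply/rowP => k; rewrite !mxE coords_map // dent0.
rewrite /potential -(@sum_pad_row R N _ (sigma Y) (ent b)) ?ent0 //.
rewrite -(@sum_pad_row R N _ (sigma X) (ent b)) ?ent0 //.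
apply: svd_bregman; rewrite ?pad_orthoP //; exact: entN.
Qed.

(** Convexity of the potential: every weight and every scalar divergence in
    the mixed sum is nonnegative. *)
Lemma potential_bregman_ge0 Y : 0 < b ->
  0 <= potential Y - potential X - frob G (Y - X).
Proof.
move=> b0; have [U' [V' [HU' HV' YE]]] := sigma_pad Y.
rewrite (potential_padE HU' HV' YE).
have s0 := pad_row_ge0 (@sigma_ge0 X); have t0 := pad_row_ge0 (@sigma_ge0 Y).
do 2!(apply: sumr_ge0 => ? _); apply: addr_ge0; rewrite mulr_ge0 ?sqr_ge0 //.
  by rewrite mul1r ent_bregman_ge0_pos.
by rewrite mulN1r ent_bregman_ge0_neg.
Qed.

(** Smoothness of the potential: the mixed sum of squares is the squared
    Frobenius distance. Together with convexity this shows that [G] is the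
    gradient at [X]. *)
Lemma potential_bregman_le Y : 0 < b ->
  potential Y - potential X - frob G (Y - X) <= frob (Y - X) (Y - X) / b.
Proof.
move=> b0; have [U' [V' [HU' HV' YE]]] := sigma_pad Y.
rewrite (potential_padE HU' HV' YE).
have s0 := pad_row_ge0 (@sigma_ge0 X); have t0 := pad_row_ge0 (@sigma_ge0 Y).
rewrite -(@frob_pad R N) // pad_mxB YE XP.
rewrite svd_dist ?pad_orthoP // mulrC mixed_sumZ.
apply: ler_mixed_sum => i j; rewrite ?mul1r ?mulN1r mulrC.
  exact: ent_bregman_upper_pos.
exact: ent_bregman_upper_neg.
Qed.

(** Strong convexity of the potential on nuclear norm balls, in dual form.
    Indices created by padding get weight zero; otherwise the term [4 b] would
    be multiplied by the padded size instead of [minn m n], and would not stay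
    bounded for [b = 1 / minn m n]. *)
Lemma potential_stability W Y al : 0 < b -> 0 < al ->
  frob W (X - Y) <= al * (potential Y - potential X - frob G (Y - X))
   + spectral_norm W ^+ 2 *
     (nuclear_norm X + nuclear_norm Y + 4 * b * (minn m n)%:R) / (2 * al).
Proof.
move=> b0 al0; have [U' [V' [HU' HV' YE]]] := sigma_pad Y.
have [U0 [V0 [HU0 HV0 WE]]] := sigma_pad W.
rewrite (potential_padE HU' HV' YE).
have s0 := pad_row_ge0 (@sigma_ge0 X); have t0 := pad_row_ge0 (@sigma_ge0 Y).
pose c (k : 'I_N) := if (k < minn m n)%N then 2 * b else 0.
have c0 k : 0 <= c k by rewrite /c; case: ifP => // _; lra.
have csum : \sum_k c k = (minn m n)%:R * (2 * b) by exact: sum_pad_support.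
pose s k := pad_row N (sigma X) ord0 k; pose t k := pad_row N (sigma Y) ord0 k.
pose w k := s k + c k.
pose w' k := t k + c k.
have -> : nuclear_norm X + nuclear_norm Y + 4 * b * (minn m n)%:R =
    \sum_k w k + \sum_k w' k.
  by rewrite !big_split /= csum !sum_pad_sigma; ring.
have weight i j (v F : R) : `|v| = t j -> 0 <= F ->
    (v - s i) ^+ 2 <= 2 * (t j + s i + 2 * b) * F ->
    (v - s i) ^+ 2 <= 2 * (w i + w' j) * F.
  move=> vt F0 H.
  have [ij|/norP[]] := boolP ((i < minn m n) || (j < minn m n))%N.
    apply: le_trans H _; rewrite ler_wpM2r // ler_wpM2l //.
    rewrite /w /w'; have ci := c0 i; have cj := c0 j.
    by case/orP: ij => H; [have cE : c i = 2 * b by rewrite /c H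
                          |have cE : c j = 2 * b by rewrite /c H]; lra.
  rewrite -!leqNgt => im jm.
  have si : s i = 0 by rewrite /s mxE coords_out.
  have tj : t j = 0 by rewrite /t mxE coords_out.
  have v0 : v = 0 by apply/eqP; rewrite -normr_eq0 vt tj.
  rewrite v0 si subr0 expr0n /= mulr_ge0 //.
  by rewrite mulr_ge0 // /w /w' !addr_ge0.
rewrite -[leLHS](@frob_pad R N) // pad_mxB -opprB frobNr -frobNl WE.
rewrite -[- (U0 *m _ *m _)]mulNmx -[- (U0 *m _)]mulNmx YE XP.
apply: svd_stability => //; rewrite ?pad_orthoP //.
- by rewrite linearN /= mulmxN mulNmx opprK.
- apply: pad_row_norm_le; first exact: spectral_norm_ge0.
  by move=> i; rewrite ger0_norm ?sigma_ge0 // sigma_le_spectral_norm.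
- by move=> i; rewrite addr_ge0.
- by move=> i; rewrite addr_ge0.
- by move=> i j; rewrite mul1r ent_bregman_ge0_pos.
- by move=> i j; rewrite mulN1r ent_bregman_ge0_neg.
- move=> i j; rewrite mul1r; apply: weight; first exact: ger0_norm.
    exact: ent_bregman_ge0_pos.
  exact: ent_bregman_lower_pos.
- move=> i j; rewrite mulN1r; apply: weight; first by rewrite normrN ger0_norm.
    exact: ent_bregman_ge0_neg.
  exact: ent_bregman_lower_neg.
Qed.

(** The left-hand side is the conjugate of the potential at its gradient, a
    sum of scalar conjugates. *)
Lemma frob_grad_dual_le : 0 < b -> frob G X - potential X <= nuclear_norm X.
Proof.
move=> b0; rewrite -(@frob_pad R N) // XP pad_svd // frob_svd_same ?pad_orthoP //.
rewrite /potential -(@sum_pad_row R N _ _ (ent b)) ?ent0 // -sum_pad_sigma -sumrB.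
apply: ler_sum => k _; rewrite [pad_row _ (map_mx _ _) _ _]mxE coords_map ?dent0 //.
rewrite mxE mulrC; apply: ent_dual_le => //.
by apply: coords_ge0; exact: sigma_ge0.
Qed.

End Gradient.
End SpectralPotential.
(** * Gradients and first-order optimality *)

Section FirstOrderConditions.
Variables (R : realType) (m n : nat).
Implicit Types (X Y G : 'M[R]_(m, n)) (K : set 'M[R]_(m, n)).

(** Along a coordinate direction the difference quotient at [k] differs from
    the entry of [G] by at most [c |k|]. *)
Lemma grad_quadratic_bound (F : 'M[R]_(m, n) -> R) X G (c : R) : 0 <= c ->
  (forall Y, `|F Y - F X - frob G (Y - X)| <= c * frob (Y - X) (Y - X)) ->
  grad F X = G.
Proof.
move=> c0 Fb; apply/matrixP => i j; rewrite mxE.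
apply: cvg_lim => //; apply/cvgrPdist_le => e e0.
have d0 : 0 < e / (c + 1) by rewrite divr_gt0 //; lra.
near=> k.
have kn0 : k != 0 by near: k; exact: nbhs_dnbhs_neq.
have ke : `|k| <= e / (c + 1).
  near: k; apply: dnbhs0_le; exact: d0.
have kp : 0 < `|k| by rewrite normr_gt0.
rewrite /=; have := Fb (k *: delta_mx i j + X).
rewrite addrK frobZr frob_delta !frobZl frobZr frob_delta mxE !eqxx mulr1 => H.
rewrite -[_ *: _]/(k^-1 * (F (k *: delta_mx i j + X) - F X)) distrC.
have -> : k^-1 * (F (k *: delta_mx i j + X) - F X) - G i j =
    k^-1 * (F (k *: delta_mx i j + X) - F X - k * G i j) by field.
rewrite normrM normfV mulrC ler_pdivrMr //.
apply: le_trans H _.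
rewrite -[k * k]expr2 -real_normK ?num_real // expr2 mulrA ler_wpM2r ?ltW //.
have := ke; rewrite ler_pdivlMr; last by lra.
by have := normr_ge0 k; nra.
Unshelve. all: by end_near. Qed.

Lemma convex_setP K : convex_set K -> forall X Y (t : R), 0 <= t -> t <= 1 ->
  K X -> K Y -> K (t *: X + (1 - t) *: Y).
Proof.
move=> cK X Y t t0 t1 KX KY.
have /set_mem := cK X Y (Itv01 t0 t1) (mem_set KX) (mem_set KY).
by [].
Qed.

Lemma convex_functionP K (f : 'M[R]_(m, n) -> R) : convex_function K f ->
  forall X Y (t : R), 0 <= t -> t <= 1 -> K X -> K Y ->
  f (t *: X + (1 - t) *: Y) <= t * f X + (1 - t) * f Y.
Proof.
move=> cf X Y t t0 t1 KX KY.
by have := cf (Itv01 t0 t1) X Y (mem_set KX) (mem_set KY).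
Qed.

(** First-order optimality, for a function [C] that need not be
    differentiable. Minimality is tested at [X + t (Y - X)]: convexity of [C]
    and the quadratic bound on [F] give [0 <= t D + t^2 q], where [D = C Y - C
    X + frob G (Y - X)] and [q] is the quadratic term; this forces [0 <= D] as
    [t] tends to zero. *)
Lemma argmin_bregman_gap K (C F : 'M[R]_(m, n) -> R) X G (c : R) : 0 <= c ->
  (forall Y Z (t : R), 0 <= t -> t <= 1 -> K Y -> K Z ->
     K (t *: Y + (1 - t) *: Z)) ->
  (forall Y Z (t : R), 0 <= t -> t <= 1 -> K Y -> K Z ->
     C (t *: Y + (1 - t) *: Z) <= t * C Y + (1 - t) * C Z) ->
  (forall Y, F Y - F X - frob G (Y - X) <= c * frob (Y - X) (Y - X)) ->
  argmin K (fun Y => C Y + F Y) X ->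
  forall Y, K Y -> F Y - F X - frob G (Y - X) <= (C Y + F Y) - (C X + F X).
Proof.
move=> c0 cK cC Fb [KX Xmin] Y KY.
suff : 0 <= C Y - C X + frob G (Y - X) by lra.
rewrite leNgt; apply/negP => D0.
set D := C Y - C X + frob G (Y - X) in D0 *.
set q := c * frob (Y - X) (Y - X).
have q0 : 0 <= q by rewrite mulr_ge0 ?frob_ge0.
(* A [t <= 1] small enough for [t * q < - D]. *)
pose t := - D / (2 * (q - D)).
have qD : 0 < 2 * (q - D) by lra.
have t0 : 0 < t by rewrite divr_gt0 //; lra.
have tE : t * (2 * (q - D)) = - D by rewrite divfK // gt_eqF.
have t1 : t <= 1 by rewrite ler_pdivrMr //; lra.
have ZE : t *: Y + (1 - t) *: X - X = t *: (Y - X).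
  by apply/matrixP => i j; rewrite !mxE; ring.
have KZ := cK Y X t (ltW t0) t1 KY KX.
have H1 := Xmin _ KZ.
have H2 := cC Y X t (ltW t0) t1 KY KX.
have H3 := Fb (t *: Y + (1 - t) *: X).
rewrite ZE !frobZr !frobZl mulrA in H3.
have : 0 <= t * D + t * (t * q).
  rewrite /D /q; move: H1 H2 H3; set FZ := F (_ + _); set CZ := C (_ + _).
  move: (frob _ _) (frob _ _) => g f; move=> H1 H2 H3; nra.
rewrite -mulrDr pmulr_rge0 //.
by nra.
Qed.

End FirstOrderConditions.

(** * Regret of optimistic follow-the-regularised-leader *)

Section OptimisticFTRL.
Variables (R : realType) (m n : nat).
Variables (K : set 'M[R]_(m, n)) (T : nat).
Variables (r : nat -> 'M[R]_(m, n) -> R) (x g h : nat -> 'M[R]_(m, n)).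
Variables (al : nat -> R) (B : 'M[R]_(m, n) -> R).
Variables (E : nat -> 'M[R]_(m, n) -> R) (dl : nat -> R).

(** Induction on [t], comparing with the leader of the round: the minimality
    gap at [x_t] (with [E t] for the Bregman divergence) allows replacing [u]
    by [x_t] in the objective, at the price [frob (g t - h t) (x t - u) - E t
    u] for having played with the hint instead of the true subgradient; then
    the induction hypothesis is used at [x_t] itself. *)
Lemma oftrl_bound :
  (forall t, 0 <= al t) -> (forall t, al t <= al t.+1) ->
  (forall u, 0 <= B u) ->
  (forall t, (1 <= t <= T)%N -> K (x t)) ->
  (forall t u, (1 <= t <= T)%N -> K u ->
     E t u <= (frob (\sum_(1 <= s < t) g s + h t) u
               + \sum_(1 <= s < t.+1) r s u + al t * B u)
            - (frob (\sum_(1 <= s < t) g s + h t) (x t)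
               + \sum_(1 <= s < t.+1) r s (x t) + al t * B (x t))) ->
  (forall t u, (1 <= t <= T)%N -> K u ->
     frob (g t - h t) (x t - u) - E t u <= dl t) ->
  forall t, (t <= T)%N -> forall u, K u ->
    \sum_(1 <= s < t.+1) (frob (g s) (x s) + r s (x s)) <=
    frob (\sum_(1 <= s < t.+1) g s) u + \sum_(1 <= s < t.+1) r s u
    + al t * B u + \sum_(1 <= s < t.+1) dl s.
Proof.
move=> al0 al_mono B0 Kx gap stab; elim=> [|t IH] tT u Ku.
  rewrite !big_geq // frobC frob0r !add0r addr0.
  by rewrite mulr_ge0.
have tT' : (1 <= t.+1 <= T)%N by [].
have Kxt := Kx _ tT'.
have H1 := gap _ u tT' Ku; have H2 := stab _ u tT' Ku.
have H3 := IH (ltnW tT) _ Kxt.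
rewrite ![\sum_(1 <= s < t.+2) _]big_nat_recr //=.
rewrite ![\sum_(1 <= s < t.+2) _]big_nat_recr //= in H1.
rewrite !frobDl in H1 *; rewrite !frobBr !frobBl in H2.
have H4 : al t * B (x t.+1) <= al t.+1 * B (x t.+1) by rewrite ler_wpM2r.
by lra.
Qed.

End OptimisticFTRL.
(** * The regulariser and its step sizes *)

Section SpectralRegulariser.
Variables (R : realType) (m n : nat) (b : R).
Hypothesis b0 : 0 < b.
Implicit Types X Y : 'M[R]_(m, n).

(** A relation rather than a function of [X], since the orthogonal factors of
    a singular value decomposition are not unique. *)
Definition is_potential_grad X (G : 'M[R]_(m, n)) : Prop :=
  exists (U : 'M[R]_m) (V : 'M[R]_n), [/\ U *m U^T = 1%:M, V *m V^T = 1%:M,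
    X = U *m rect_diag (sigma X) *m V^T &
    G = U *m rect_diag (map_mx (dent b) (sigma X)) *m V^T].

Lemma potential_grad_exists X : exists G, is_potential_grad X G.
Proof.
have [U [V [HU HV XE]]] := sigma_svd X.
by exists (U *m rect_diag (map_mx (dent b) (sigma X)) *m V^T), U, V.
Qed.

Lemma bregman_potential al X G Y : 0 <= al -> is_potential_grad X G ->
  bregman (fun Z => al * potential b Z) Y X =
  al * (potential b Y - potential b X - frob G (Y - X)).
Proof.
move=> al0 [U [V [HU HV XE GE]]]; rewrite /bregman.
rewrite (@grad_quadratic_bound _ _ _ _ X (al *: G) (al / b)).
- by rewrite frobZl; ring.
- by rewrite divr_ge0 // ltW.
move=> Z; rewrite frobZl -!mulrBr normrM ger0_norm // -mulrA ler_wpM2l // GE.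
rewrite ger0_norm; last exact: potential_bregman_ge0.
by rewrite mulrC; exact: potential_bregman_le.
Qed.

End SpectralRegulariser.

Section Diameter.
Variables (R : realType) (m n : nat) (D : R).
Let d := minn m n.
Let b : R := d%:R^-1.
Let L : R := log_dim m n D.

(** The divergence is [potential Y] plus the conjugate at [G] minus [frob G
    Y]; these are at most [(D + 1) L], [D] and [D L], because every logarithm
    involved is at most [ln (D d + 1) <= ln ((D + 1) d) = L]. *)
Lemma potential_diameter (X Y G : 'M[R]_(m, n)) : (0 < d)%N -> 1 <= D -> 1 <= L ->
  nuclear_norm X <= D -> nuclear_norm Y <= D -> is_potential_grad b X G ->
  potential b Y - potential b X - frob G (Y - X) <= 4 * D * L.
Proof.
move=> d0 D1 L1 XD YD [U [V [HU HV XE GE]]].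
have dp : 0 < d%:R :> R by rewrite ltr0n.
have d1 : 1 <= d%:R :> R by rewrite ler1n.
have b0 : 0 < b by rewrite invr_gt0.
have lnL (s : R) : 0 <= s -> s <= D -> ln (s / b + 1) <= L.
  move=> s0 sD; rewrite /b invrK /L /log_dim -lnM ?posrE //; last by lra.
  by rewrite ler_ln ?posrE; nra.
have sig_le (Z : 'M[R]_(m, n)) i : nuclear_norm Z <= D -> sigma Z ord0 i <= D.
  apply: le_trans; rewrite /nuclear_norm (bigD1 i) //= lerDl.
  by apply: sumr_ge0 => k _; exact: sigma_ge0.
have H1 : potential b Y <= (D + 1) * L.
  apply: (@le_trans _ _ ((nuclear_norm Y + d%:R * b) * L)).
    have -> : d%:R * b = \sum_(i < d) b.
      by rewrite big_const_ord iter_addr_0 mulr_natl.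
    rewrite /nuclear_norm -big_split /= mulr_suml; apply: ler_sum => i _.
    rewrite /ent ger0_norm ?sigma_ge0 // lerBlDr.
    have s0 := sigma_ge0 Y i; have sD := sig_le Y i YD.
    have H := lnL _ s0 sD.
    have : (sigma Y ord0 i + b) * ln (sigma Y ord0 i / b + 1) <=
       (sigma Y ord0 i + b) * L by rewrite ler_wpM2l //; lra.
    by lra.
  rewrite ler_wpM2r //; first by lra.
  by rewrite /b mulfV ?gt_eqF // lerD2r.
have H2 : frob G X - potential b X <= D.
  apply: le_trans XD; rewrite GE; exact: frob_grad_dual_le.
have H3 : - frob G Y <= D * L.
  rewrite GE -frobNl -!mulNmx mulrC.
  apply: (@le_trans _ _ (L * nuclear_norm Y)); last by rewrite ler_wpM2l //; lra.
  apply: frob_le_nuclear => //; first by rewrite linearN /= mulmxN mulNmx opprK.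
    by lra.
  move=> i; rewrite mxE ger0_norm ?dent_ge0 ?sigma_ge0 //.
  by apply: lnL; [exact: sigma_ge0|exact: sig_le].
rewrite frobBr.
by nra.
Qed.

End Diameter.

Section Tuning.
Variable R : realType.

(** [S] and [S'] are the roots of the sums of squares before and after adding
    [a^2], and [S / q] is the step parameter. If [a <= S] then [S'] and [S]
    are comparable and the strong convexity bound [a^2 / S] is of the order of
    [S' - S]; if [a > S] then [a] itself is, and the trivial bound [2 D a] is
    enough. The second case makes up for the step parameter not including the
    current round. *)
Lemma stability_telescopes (D q S S' a p B : R) :
  1 <= D -> 1 <= q -> 0 <= S -> 0 <= S' -> 0 <= a -> 0 <= B ->
  S' ^+ 2 = S ^+ 2 + a ^+ 2 -> p <= 2 * D * a ->
  (0 < S -> p <= S / q * B + a ^+ 2 * (2 * D + 4) / (2 * (S / q))) ->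
  p - S / q * B <= 9 * D * q * (S' - S).
Proof.
move=> D1 q1 S0 S'0 a0 B0 SE p2 pal.
have SS' : S <= S' by rewrite -ler_sqr ?nnegrE // SE lerDl sqr_ge0.
have aE : a ^+ 2 = (S' - S) * (S' + S) by rewrite -subr_sqr SE; ring.
have sB : 0 <= S / q * B by rewrite mulr_ge0 // divr_ge0 //; lra.
have Dq : D <= D * q by rewrite ler_peMr //; lra.
have far : a <= 3 * (S' - S) -> p - S / q * B <= 9 * D * q * (S' - S).
  move=> H.
  have H1 : D * a <= D * (3 * (S' - S)) by rewrite ler_wpM2l //; lra.
  have H2 : D * (S' - S) <= D * q * (S' - S) by rewrite ler_wpM2r //; lra.
  have H3 : 0 <= D * q * (S' - S) by rewrite !mulr_ge0 //; lra.
  by lra.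
have [Sa|aS] := ltP S a.
  apply: far; have ap : 0 < a by lra.
  have S'a : S' <= 2 * a by rewrite -ler_sqr ?nnegrE //; nra.
  rewrite -(ler_pM2l ap) -expr2 aE.
  have : (S' - S) * (S' + S) <= (S' - S) * (3 * a) by rewrite ler_wpM2l //; lra.
  by lra.
have [S00|Sn0] := eqVneq S 0; first by apply: far; lra.
have Sp : 0 < S by rewrite lt_def Sn0.
have {}pal := pal Sp.
have S'S : S' <= 2 * S by rewrite -ler_sqr ?nnegrE //; nra.
have aS3 : a ^+ 2 <= (S' - S) * (3 * S).
  by rewrite aE ler_wpM2l //; lra.
suff : a ^+ 2 * (2 * D + 4) / (2 * (S / q)) <= 9 * D * q * (S' - S) by lra.
have qp : 0 < q by lra.
have -> : a ^+ 2 * (2 * D + 4) / (2 * (S / q)) = a ^+ 2 * ((D + 2) * q) / S.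
  by field; rewrite !gt_eqF.
rewrite ler_pdivrMr //.
apply: (@le_trans _ _ ((S' - S) * (3 * S) * ((3 * D) * q))).
  apply: ler_pM; rewrite ?sqr_ge0 //; first by rewrite mulr_ge0 //; lra.
  by rewrite ler_wpM2r //; lra.
by rewrite le_eqVlt; apply/orP; left; apply/eqP; ring.
Qed.

Lemma log_dim_ge1 m n (D : R) : expR 1 < (minn m n)%:R :> R -> 1 <= D ->
  1 <= log_dim m n D.
Proof.
move=> em D1; rewrite /log_dim.
have d0 : 0 < (minn m n)%:R :> R by apply: lt_trans em; exact: expR_gt0.
have : 1 <= ln (minn m n)%:R :> R.
  by rewrite -[leLHS](expRK 1) ler_ln ?posrE ?expR_gt0 // ltW.
by have := @ln_ge0 R (D + 1); lra.
Qed.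

End Tuning.
(** * The regret bound *)

Section FTRLStep.
Variables (R : realType) (m n : nat).
Implicit Types (X Y G w : 'M[R]_(m, n)) (K : set 'M[R]_(m, n)).

(** The centre [X1] of the Bregman term only contributes an affine function,
    which goes with the convex part of the objective. *)
Lemma ftrl_gap K w (rs : 'M[R]_(m, n) -> R) (al b : R) X1 G1 X G :
  0 <= al -> 0 < b -> convex_set K ->
  (forall Y Z (t : R), 0 <= t -> t <= 1 -> K Y -> K Z ->
     rs (t *: Y + (1 - t) *: Z) <= t * rs Y + (1 - t) * rs Z) ->
  is_potential_grad b X G ->
  let obj Y := frob w Y + rs Y
    + al * (potential b Y - potential b X1 - frob G1 (Y - X1)) in
  argmin K obj X -> forall Y, K Y ->
  al * (potential b Y - potential b X - frob G (Y - X)) <= obj Y - obj X.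
Proof.
move=> al0 b0 cK crs [U [V [HU HV XE GE]]] obj objX Y KY.
pose C Y := frob w Y + rs Y - al * (potential b X1 + frob G1 (Y - X1)).
have objE : obj = (fun Z => C Z + al * potential b Z).
  by apply/funext => Z; rewrite /obj /C; ring.
rewrite objE in objX *.
have := @argmin_bregman_gap _ _ _ K C (fun Z => al * potential b Z) X (al *: G)
  (al / b) _ _ _ _ objX Y KY.
rewrite frobZl !mulrBr; apply.
- by rewrite divr_ge0 // ltW.
- exact: convex_setP.
- move=> Z1 Z2 t t0 t1 K1 K2; rewrite /C.
  have := crs _ _ _ t0 t1 K1 K2.
  rewrite !frobBr !frobDr !frobZr; lra.
- move=> Z; rewrite frobZl -!mulrBr mulrAC -mulrA ler_wpM2l // GE.
  exact: potential_bregman_le.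
Qed.

Lemma sum_convex K (r : nat -> 'M[R]_(m, n) -> R) t :
  (forall s, (1 <= s < t)%N -> convex_function setT (r s)) ->
  forall Y Z (a : R), 0 <= a -> a <= 1 ->
  \sum_(1 <= s < t) r s (a *: Y + (1 - a) *: Z) <=
  a * \sum_(1 <= s < t) r s Y + (1 - a) * \sum_(1 <= s < t) r s Z.
Proof.
move=> cr Y Z a a0 a1; rewrite !mulr_sumr -big_split /=.
by apply: ler_sum_nat => s st; apply: (convex_functionP (cr s st)).
Qed.

End FTRLStep.

Lemma regret_le (R : realType) m n (K : set 'M[R]_(m, n))
    (l r : nat -> 'M[R]_(m, n) -> R) x T (c : R) :
  K !=set0 ->
  (forall u, K u ->
    cumulative_loss l r T x - cumulative_loss l r T (fun=> u) <= c) ->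
  regret K l r x T <= c.
Proof.
move=> [u0 Ku0] H; rewrite /regret lerBlDr -lerBlDl.
apply: lb_le_inf; first by exists (cumulative_loss l r T (fun=> u0)), u0.
by move=> _ [u Ku <-]; rewrite lerBlDl -lerBlDr H.
Qed.

(** The constant is [4 + 9]: the first from the divergence to the centre at
    the final step parameter, the second from the telescoping stability terms.
    *)
Lemma ftrl_regret (R : realType) (m n : nat) (D : R) (K : set 'M[R]_(m, n))
    (T : nat) (l r : nat -> 'M[R]_(m, n) -> R) (x g h : nat -> 'M[R]_(m, n)) :
  (0 < T)%N -> (0 < minn m n)%N -> 1 <= log_dim m n D ->
  1 <= D -> convex_set K ->
  (forall X, K X -> nuclear_norm X <= D) ->
  (forall t, (1 <= t <= T)%N -> convex_function setT (r t)) ->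
  (forall t, (1 <= t <= T)%N -> subdifferential K (l t) (x t) (g t)) ->
  ftrl_update K r g h (spectral_reg D g h) x T ->
  regret K l r x T <= 13 * (D * Num.sqrt (log_dim m n D)) *
    Num.sqrt (\sum_(1 <= t < T.+1) spectral_norm (g t - h t) ^+ 2).
Proof.
move=> T0 d0 L1 D1 cK KD cr sub upd.
set L := log_dim m n D in L1 *; set q := Num.sqrt L.
have q1 : 1 <= q by rewrite -sqrtr1 ler_wsqrtr.
have q2 : q ^+ 2 = L by rewrite sqr_sqrtr //; lra.
pose b : R := (minn m n)%:R^-1.
have b0 : 0 < b by rewrite invr_gt0 ltr0n.
have bd : b * (minn m n)%:R = 1 by rewrite mulVf // gt_eqF // ltr0n.
pose a t := spectral_norm (g t - h t).
pose A t := \sum_(1 <= s < t) a s ^+ 2.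
pose S t := Num.sqrt (A t).
have A0 t : 0 <= A t by apply: sumr_ge0 => s _; rewrite sqr_ge0.
have AS t : (0 < t)%N -> A t.+1 = A t + a t ^+ 2.
  by move=> t0; rewrite /A big_nat_recr.
have alE t : alpha D g h t = S t / q.
  by rewrite /alpha /Defs.eta -/L div1r sqrtrV 1?mulrC //; lra.
have al0 t : 0 <= alpha D g h t by rewrite alE divr_ge0 ?sqrtr_ge0.
(* One gradient is fixed at every point, the centre [x 1] included. *)
have [G HG] := choice (@potential_grad_exists R m n b).
have Kx t : (1 <= t <= T)%N -> K (x t).
  by case: t => // t /= tT; have [] := upd t tT.
have T1 : (1 <= 1 <= T)%N by [].
pose Bd u := potential b u - potential b (x 1%N) - frob (G (x 1%N)) (u - x 1%N).
have BdE t u : bregman (spectral_reg D g h t) u (x 1%N) = alpha D g h t * Bd u.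
  exact: bregman_potential.
pose E t u := alpha D g h t *
  (potential b u - potential b (x t) - frob (G (x t)) (u - x t)).
pose dl t := 9 * D * q * (S t.+1 - S t).
have Bge0 X Y : 0 <= potential b Y - potential b X - frob (G X) (Y - X).
  by have [U [V [HU HV XE ->]]] := HG X; exact: potential_bregman_ge0.
have main := @oftrl_bound R m n K T r x g h (alpha D g h) Bd E dl al0 _ _ Kx _ _
  T (leqnn T).
apply: regret_le; first by exists (x 1%N); exact: Kx.
move=> u Ku.
have {main} main : \sum_(1 <= s < T.+1) (frob (g s) (x s) + r s (x s)) <=
    frob (\sum_(1 <= s < T.+1) g s) u + \sum_(1 <= s < T.+1) r s u
    + alpha D g h T * Bd u + \sum_(1 <= s < T.+1) dl s.
  apply: main => //.
  - move=> t; rewrite !alE ler_wpM2r ?invr_ge0 ?sqrtr_ge0 //.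
    apply: ler_wsqrtr; rewrite /A; case: t => [|t]; first by rewrite !big_geq.
    by rewrite [leRHS]big_nat_recr //= lerDl sqr_ge0.
  - by move=> v; exact: Bge0.
  - case=> // t v /= tT Kv.
    have := @ftrl_gap R m n K (\sum_(1 <= s < t.+1) g s + h t.+1)
      (fun Y => \sum_(1 <= s < t.+2) r s Y) (alpha D g h t.+1) b (x 1%N)
      (G (x 1%N)) (x t.+1) (G (x t.+1)) (al0 _) b0 cK _ (HG _) _ v Kv.
    apply.
      move=> Y Z c c0 c1 _ _; apply: sum_convex => // s /andP[s1 st].
      by apply: cr; rewrite s1 (leq_trans _ tT).
    have := upd t tT; rewrite /ftrl_objective.
    by under eq_fun do rewrite BdE.
  - move=> t v tT Kv; rewrite /E /dl alE.
    have [t1 _] := andP tT.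
    apply: (@stability_telescopes R D q (S t) (S t.+1) (a t)) => //;
      rewrite ?sqrtr_ge0 ?spectral_norm_ge0 //.
    + by rewrite !sqr_sqrtr // AS.
    + rewrite frobBr.
      have /ler_normlP[_ H1] := frob_le_spectral_nuclear (g t - h t) (x t).
      have /ler_normlP[H2 _] := frob_le_spectral_nuclear (g t - h t) v.
      have H3 : a t * nuclear_norm (x t) <= a t * D.
        by rewrite ler_wpM2l ?spectral_norm_ge0 // KD //; exact: Kx.
      have H4 : a t * nuclear_norm v <= a t * D.
        by rewrite ler_wpM2l ?spectral_norm_ge0 // KD.
      by rewrite /a in H3 H4 *; lra.
    + move=> S0; have Sq : 0 < S t / q by rewrite divr_gt0 //; lra.
      have [U [V [HU HV XE GE]]] := HG (x t).
      have := potential_stability HU HV XE (g t - h t) v b0 Sq.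
      rewrite -GE => /le_trans; apply; rewrite lerD2l ler_wpM2r //.
        by rewrite invr_ge0; lra.
      rewrite ler_wpM2l ?sqr_ge0 // -mulrA bd.
      have := KD _ (Kx _ tT); have := KD _ Kv; lra.
have dlE : \sum_(1 <= s < T.+1) dl s = 9 * D * q * S T.+1.
  rewrite -mulr_sumr telescope_sumr //.
  by rewrite [S 1%N]/S /A big_geq // sqrtr0 subr0.
have BdL : Bd u <= 4 * D * L.
  by apply: potential_diameter; rewrite ?KD //; exact: Kx.
have alB : alpha D g h T * Bd u <= 4 * (D * q) * S T.+1.
  rewrite alE.
  have SS : S T <= S T.+1.
    by apply: ler_wsqrtr; rewrite AS // lerDl sqr_ge0.
  have q0 : 0 < q by lra.
  apply: (@le_trans _ _ (S T / q * (4 * D * L))).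
    by rewrite ler_wpM2l // divr_ge0 ?sqrtr_ge0 // ltW.
  rewrite -q2 (_ : S T / q * (4 * D * q ^+ 2) = 4 * (D * q) * S T); last first.
    by field; rewrite gt_eqF.
  by rewrite ler_wpM2l // !mulr_ge0 //; lra.
rewrite /cumulative_loss.
have lin : \sum_(1 <= t < T.+1) (l t (x t) + r t (x t))
    - \sum_(1 <= t < T.+1) (l t u + r t u) <=
    \sum_(1 <= s < T.+1) (frob (g s) (x s) + r s (x s))
    - frob (\sum_(1 <= s < T.+1) g s) u - \sum_(1 <= s < T.+1) r s u.
  have -> : frob (\sum_(1 <= s < T.+1) g s) u = \sum_(1 <= s < T.+1) frob (g s) u.
    elim: (T.+1) => [|k IH]; first by rewrite !big_geq // frobC frob0r.
    case: k IH => [|k] IH; first by rewrite !big_geq // frobC frob0r.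
    by rewrite !(big_nat_recr k.+1) //= frobDl IH.
  rewrite -!sumrB; apply: ler_sum_nat => t tT.
  have := sub t tT u Ku; rewrite frobBr; lra.
rewrite -/(A T.+1) -/(S T.+1); rewrite dlE in main; lra.
Qed.
Theorem theorem5 (R : realType) :
  exists c : nat -> nat -> R -> R,
    (exists (C D0 : R) (d0 : nat), forall (m n : nat) (D : R),
        D0 <= D -> (d0 <= minn m n)%N ->
        c m n D <= C * (D * Num.sqrt (log_dim m n D))) /\
    (forall (m n : nat) (D : R) (K : set 'M[R]_(m, n)) (T : nat)
        (l r : nat -> 'M[R]_(m, n) -> R) (x g h : nat -> 'M[R]_(m, n)),
      expR 1 < (minn m n)%:R :> R ->
      1 <= D ->
      compact K ->
      convex_set K ->
      (forall X, K X -> nuclear_norm X <= D) ->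
      (forall t, (1 <= t <= T)%N -> convex_function K (l t)) ->
      (forall t, (1 <= t <= T)%N ->
        [/\ forall X, 0 <= r t X,
            convex_function setT (r t) & closed_function (r t)]) ->
      (forall t, (1 <= t <= T)%N -> subdifferential K (l t) (x t) (g t)) ->
      ftrl_update K r g h (spectral_reg D g h) x T ->
      regret K l r x T <=
        c m n D * Num.sqrt (\sum_(1 <= t < T.+1) spectral_norm (g t - h t) ^+ 2)).
Proof.
exists (fun m n D => 13 * (D * Num.sqrt (log_dim m n D))); split.
  by exists 13, 0, 0%N.
move=> m n D K T l r x g h em D1 _ cK KD _ rP sub upd.
have d0 : (0 < minn m n)%N.
  by rewrite -(ltr0n R); apply: lt_trans em; exact: expR_gt0.
case: (posnP T) => [T0|T0]; last first.
  apply: ftrl_regret => //; first exact: log_dim_ge1.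
  by move=> t /rP[].
(* Without rounds nothing places [x 1] in [K]; the infimum is then over the
   singleton of the empty sum or, if [K] is empty, over the empty set. *)
rewrite T0 [leRHS](_ : _ = 0); last by rewrite big_geq // sqrtr0 mulr0.
have [[u Ku]|K0] := pselect (K !=set0).
  apply: regret_le; first by exists u.
  by move=> v _; rewrite /cumulative_loss !big_geq // subr0.
rewrite /regret /cumulative_loss big_geq // sub0r oppr_le0.
have /nonemptyPn -> := K0.
by rewrite image_set0 inf0.
Qed.
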